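(* The map $\langle\cdot\rangle:\mathrm{2Hilb}_m\to\mathrm{FinSpaces}$ is a weak 2-functor, with unitary coherence 2-cells, and is an equivalence of 2-categories. Moreover it is a unitary linear map at the level of the 2-morphisms.
   Context: Inner products are linear in the second variable; 2-categories are weak. **$\mathrm{2Hilb}_m$.** An $H^*$-category is a category enriched in finite-dimensional complex Hilbert spaces (with linear maps), with antilinear maps $*:\mathrm{Hom}(x,y)\to\mathrm{Hom}(y,x)$ such that $f^{**}=f$, $(fg)^*=g^*f^*$, $(fg,h)=(g,f^*h)$, $(fg,h)=(f,hg^* )$ whenever defined. A 2-Hilbert space is a Cauchy complete $H^*$-category (equivalently: finite direct sums exist and idempotents split). It is semisimple; finite-dimensional means finitely many isomorphism classes of simple objects. It is marked if each isomorphism class of simple objects has a distinguished representative $e_i$; the scale factor is $k_i=(\mathrm{id}_{e_i},\mathrm{id}_{e_i})>0$. $\mathrm{2Hilb}_m$ has finite-dimensional marked 2-Hilbert spaces as objects, linear $*$-functors ($F$ linear on hom-sets, $F(f^* )=F(f)^*$; no regard for markings) as morphisms, natural transformations as 2-morphisms, with inner product $\langle\theta,\theta'\rangle=\sum_ik_i(\theta_{e_i},\theta'_{e_i})$ over the marked simple objects of the source. **$\mathrm{FinSpaces}$.** An object is a finite set $X$ with positive reals $k_x$, $x\in X$. A morphism $E:X\to Y$ is a bundle of finite-dimensional Hilbert spaces over $Y\times X$, fibres $\langle y|E|x\rangle$. A 2-morphism is a map of vector bundles (fibrewise linear maps). Composition is by convolution: $\langle z|F\circ E|x\rangle=\bigoplus_{y\in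 Y}\frac1{k_y}\langle z|F|y\rangle\otimes\langle y|E|x\rangle$, meaning that the inner product on the $y$-component is $(v_1\otimes w_1,v_2\otimes w_2)=\frac1{k_y}(v_1,v_2)(w_1,w_2)$ (direct sum taken as the unordered space of sections over $Y$). The identity has fibres $\langle y|\mathrm{id}|x\rangle=\delta_{x,y}k_x\mathbb C$, i.e. $(1,1)=k_x$ on the diagonal. For 2-morphisms $f,g:E\Rightarrow F$ between $E,F:X\to Y$: $\langle f,g\rangle=\sum_{x\in X,y\in Y}k_xk_y\mathrm{Tr}(f_{y,x}^*g_{y,x})$. **The map.** $\langle H\rangle$ is the set of marked simple objects with their scale factors. For $F:H\to H'$, $\langle F\rangle$ has fibres $\langle\mu|F|i\rangle=\mathrm{Hom}(e_\mu,Fe_i)$. For $\theta:F\Rightarrow G$, $\langle\theta\rangle_{\mu,i}$ is postcomposition with $\theta_{e_i}$. The compositor $\langle G\rangle\circ\langle F\rangle\to\langle G\circ F\rangle$ is, for $f\in\langle\mu|F|i\rangle$, $g\in\langle\lambda|G|\mu\rangle$, $g\otimes f\mapsto G(f)\circ g$; the unit coherence $\mathrm{id}_{\langle H\rangle}\to\langle\mathrm{id}_H\rangle$ sends $1\mapsto\mathrm{id}_{e_i}$ on the diagonal fibres. *)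

(* Defs.v *)
From HB Require Import structures.
From mathcomp Require Import all_boot all_order all_algebra.
From mathcomp Require Import boolp.

Set Implicit Arguments.
Unset Strict Implicit.
Unset Printing Implicit Defensive.
Import Order.TTheory GRing.Theory Num.Theory.
Local Open Scope ring_scope.

(* Scalars live in a numClosedFieldType C, to be instantiated with R[i].  There
   0 < z means that z is real and positive, so "positive real" weights and
   scale factors are elements z of C with 0 < z. *)

(* The inner product is linear in the second variable. *)
Record hilb (C : numClosedFieldType) := Hilb {
  hilb_vect :> vectType C;
  ip : hilb_vect -> hilb_vect -> C;
  ip_scalar : forall u, scalar (ip u);
  ip_conj : forall u v, ip v u = (ip u v)^*;
  ip_gt0 : forall u, u != 0 -> 0 < ip u u }.

Section HilbTheory.
Variables (C : numClosedFieldType).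

Section One.
Variable V : hilb C.
Implicit Types u v w : V.

HB.instance Definition _ u :=
  GRing.isLinear.Build C V C _ (ip u) (ip_scalar u).

Lemma ipDr u v w : ip u (v + w) = ip u v + ip u w. Proof. exact: raddfD. Qed.
Lemma ipZr u a v : ip u (a *: v) = a * ip u v. Proof. exact: linearZ. Qed.
Lemma ip0r u : ip u 0 = 0. Proof. exact: raddf0. Qed.
Lemma ipBr u v w : ip u (v - w) = ip u v - ip u w. Proof. exact: raddfB. Qed.
Lemma ip_sumr u I r (P : pred I) F :
  ip u (\sum_(i <- r | P i) F i) = \sum_(i <- r | P i) ip u (F i).
Proof. exact: raddf_sum. Qed.
Lemma ipDl u v w : ip (u + v) w = ip u w + ip v w.
Proof. by rewrite ip_conj ipDr rmorphD /= -!ip_conj. Qed.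
Lemma ipZl u a v : ip (a *: v) u = a^* * ip v u.
Proof. by rewrite ip_conj ipZr rmorphM /= -ip_conj. Qed.
Lemma ip0l u : ip 0 u = 0. Proof. by rewrite ip_conj ip0r rmorph0. Qed.
Lemma ip_suml u I r (P : pred I) F :
  ip (\sum_(i <- r | P i) F i) u = \sum_(i <- r | P i) ip (F i) u.
Proof. by rewrite ip_conj ip_sumr rmorph_sum; apply: eq_bigr => i _ /=; rewrite -ip_conj. Qed.
Lemma ip_inj u v : (forall w, ip w u = ip w v) -> u = v.
Proof.
move=> e; apply/eqP; rewrite -subr_eq0; apply/negP => /negP /ip_gt0.
by rewrite ipBr e subrr ltxx.
Qed.

Lemma onb_exists : exists b : seq V,
  (forall i j : 'I_(size b), ip b`_i b`_j = (i == j)%:R) /\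
  (forall v, v = \sum_(i < size b) ip b`_i v *: b`_i).
Proof.
have ext : forall n (b : seq V),
    (forall i j : 'I_(size b), ip b`_i b`_j = (i == j)%:R) ->
    (dim V <= n + size b)%N ->
  exists b : seq V,
  (forall i j : 'I_(size b), ip b`_i b`_j = (i == j)%:R) /\
  (forall v, v = \sum_(i < size b) ip b`_i v *: b`_i).
  have coef (b : seq V) (k : 'I_(size b) -> C) (i : 'I_(size b)) :
      (forall i j : 'I_(size b), ip b`_i b`_j = (i == j)%:R) ->
      ip b`_i (\sum_j k j *: b`_j) = k i.
    move=> ob; rewrite ip_sumr (bigD1 i) //= ipZr ob eqxx mulr1 big1 ?addr0//.
    by move=> j ne; rewrite ipZr ob eq_sym (negPf ne) mulr0.
  have frb (b : seq V) :
      (forall i j : 'I_(size b), ip b`_i b`_j = (i == j)%:R) -> free b.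
    move=> ob; apply/(@freeP _ _ _ (in_tuple b)) => k /= e i.
    by rewrite -(coef b k i ob) e ip0r.
  have grow (b : seq V) :
      (forall i j : 'I_(size b), ip b`_i b`_j = (i == j)%:R) ->
      (forall v, v = \sum_(i < size b) ip b`_i v *: b`_i) \/
      exists u, forall i j : 'I_(size (u :: b)),
        ip (u :: b)`_i (u :: b)`_j = (i == j)%:R.
    move=> ob; have [|/existsNP[v /eqP]] :=
      pselect (forall v, v = \sum_(i < size b) ip b`_i v *: b`_i); first by left.
    rewrite -subr_eq0; set w := (X in X != 0) => w0; right.
    have bw (i : 'I_(size b)) : ip b`_i w = 0.
      by rewrite ipBr (coef b (fun i => ip b`_i v) i ob) subrr.
    have wb (i : 'I_(size b)) : ip w b`_i = 0 by rewrite ip_conj bw rmorph0.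
    pose c := (sqrtC (ip w w))^-1.
    have c0 : 0 < c by rewrite invr_gt0 sqrtC_gt0 ip_gt0.
    exists (c *: w) => i j.
    case: (unliftP ord0 i) (unliftP ord0 j) => [i' ->|->] [j' ->|->] /=.
    - by rewrite ob.
    - by rewrite ipZr bw mulr0.
    - by rewrite ipZl wb mulr0.
    rewrite ?eqxx ipZr ipZl (CrealP _) ?gtr0_real// mulrA -expr2.
    by rewrite exprVn sqrtCK mulVf// lt0r_neq0 ?ip_gt0.
  elim=> [|n IH] b ob le.
    case: (grow b ob) => [sp|[u obu]]; first by exists b.
    have /frb := obu; rewrite /free => /eqP.
    move=> e; have := dimvS (subvf <<u :: b>>); rewrite e dimvf /=.
    by move=> h; have := leq_trans h le; rewrite add0n ltnn.
  case: (grow b ob) => [sp|[u obu]]; first by exists b.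
  by apply: (IH (u :: b) obu); rewrite /= addnS -addSn.
by apply: (ext (dim V) [::]); [case|rewrite addn0].
Qed.

(* A chosen orthonormal basis: onb is the list, hbase its enumeration. *)
Definition onb : seq V := sval (cid onb_exists).
Definition hdim : nat := size onb.
Definition hbase (i : 'I_hdim) : V := onb`_i.
Lemma hbase_on i j : ip (hbase i) (hbase j) = (i == j)%:R.
Proof. by have [+ _] := svalP (cid onb_exists); apply. Qed.
Lemma hbase_exp v : v = \sum_i ip (hbase i) v *: hbase i.
Proof. by have [_ +] := svalP (cid onb_exists); apply. Qed.
Lemma parseval u v : ip u v = \sum_i (ip (hbase i) u)^* * ip (hbase i) v.
Proof.
rewrite {1}(hbase_exp u) ip_suml; apply: eq_bigr => i _.
by rewrite ipZl.
Qed.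
End One.

Section Adjoint.
Variables V W : hilb C.
Variable f : 'Hom(V, W).
Definition adj_fun (w : W) : V := \sum_i ip (f (hbase i)) w *: hbase i.
Lemma adj_fun_linear : linear adj_fun.
Proof.
move=> a u v; rewrite /adj_fun scaler_sumr -big_split /=; apply: eq_bigr => i _.
by rewrite ipDr ipZr scalerDl scalerA.
Qed.
HB.instance Definition _ := GRing.isLinear.Build C W V _ adj_fun adj_fun_linear.
Definition adj : 'Hom(W, V) := linfun adj_fun.
Lemma adjP v w : ip (f v) w = ip v (adj w).
Proof.
rewrite lfunE /= /adj_fun ip_sumr {1}(hbase_exp v) linear_sum ip_suml.
apply: eq_bigr => i _.
by rewrite linearZ ipZl ipZr mulrC; congr (_ * _); rewrite -ip_conj.
Qed.
End Adjoint.

Definition htrace (V : hilb C) (h : 'End(V)) : C :=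
  \tr (\matrix_(i, j) ip (hbase i) (h (hbase j))).
End HilbTheory.

Section Tensor.
Variables (C : numClosedFieldType) (V W : hilb C).

Definition mx_ip m n (A B : 'M[C]_(m, n)) : C := \sum_i \sum_j (A i j)^* * B i j.
Lemma mx_ip_scalar m n (A : 'M[C]_(m, n)) : scalar (mx_ip A).
Proof.
move=> a B D; rewrite /mx_ip mulr_sumr -big_split; apply: eq_bigr => i _ /=.
rewrite mulr_sumr -big_split; apply: eq_bigr => j _ /=.
by rewrite !mxE mulrDr mulrCA.
Qed.
Lemma mx_ip_conj m n (A B : 'M[C]_(m, n)) : mx_ip B A = (mx_ip A B)^*.
Proof.
rewrite /mx_ip rmorph_sum; apply: eq_bigr => i _ /=.
rewrite rmorph_sum; apply: eq_bigr => j _ /=.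
by rewrite rmorphM /= conjCK mulrC.
Qed.
Lemma mx_ip_gt0 m n (A : 'M[C]_(m, n)) : A != 0 -> 0 < mx_ip A A.
Proof.
move=> A0; have ge i j : 0 <= (A i j)^* * A i j by rewrite mulrC mul_conjC_ge0.
rewrite lt_def sumr_ge0 ?andbT => [|i _]; last by rewrite sumr_ge0.
apply: contraNneq A0 => /eqP; rewrite psumr_eq0 => [/allP z|i _]; last by rewrite sumr_ge0.
apply/eqP/matrixP => i j; rewrite mxE; apply/eqP.
have := z i; rewrite mem_index_enum psumr_eq0 // => /(_ isT)/allP/(_ j).
by rewrite mem_index_enum mulrC => /(_ isT); rewrite mul_conjC_eq0.
Qed.

Definition mx_hilb m n : hilb C :=
  Hilb (@mx_ip_scalar m n) (@mx_ip_conj m n) (@mx_ip_gt0 m n).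

(* V (x) W is realised as the coefficient matrices with respect to the chosen
   orthonormal bases of V and W, and tpure v w is the pure tensor.  The universal
   property is tlift_pure together with tens_exp, and ip_tpure is the defining
   property of the inner product. *)
Definition tens : hilb C := mx_hilb (hdim V) (hdim W).
Definition tpure (v : V) (w : W) : tens :=
  \matrix_(i, j) (ip (hbase i) v * ip (hbase j) w).
Lemma ip_tpure v w v' w' : ip (tpure v w) (tpure v' w') = ip v v' * ip w w'.
Proof.
rewrite [in RHS]parseval (parseval w) mulr_suml; apply: eq_bigr => i _ /=.
rewrite mulr_sumr; apply: eq_bigr => j _.
by rewrite !mxE rmorphM /= mulrACA.
Qed.
End Tensor.
Arguments tpure {C V W}.

Section Sections.
Variables (C : numClosedFieldType) (Y : finType) (V : Y -> vectType C).
Definition sect := {dffun forall y : Y, V y}.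
HB.instance Definition _ := Choice.on sect.
Definition mksect (f : forall y, V y) : sect := finfun f.
Lemma mksectE f y : mksect f y = f y. Proof. by rewrite ffunE. Qed.
Lemma sectP (s t : sect) : (forall y, s y = t y) <-> s = t.
Proof. exact: ffunP. Qed.
Definition sect_zero := mksect (fun=> 0).
Definition sect_opp (s : sect) := mksect (fun y => - s y).
Definition sect_add (s t : sect) := mksect (fun y => s y + t y).
Definition sect_scale a (s : sect) := mksect (fun y => a *: s y).
Fact sect_addA : associative sect_add.
Proof. by move=> a b c; apply/sectP => y; rewrite !mksectE addrA. Qed.
Fact sect_addC : commutative sect_add.
Proof. by move=> a b; apply/sectP => y; rewrite !mksectE addrC. Qed.
Fact sect_add0 : left_id sect_zero sect_add.
Proof. by move=> a; apply/sectP => y; rewrite !mksectE add0r. Qed.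
Fact sect_addN : left_inverse sect_zero sect_opp sect_add.
Proof. by move=> a; apply/sectP => y; rewrite !mksectE addNr. Qed.
HB.instance Definition _ :=
  GRing.isZmodule.Build sect sect_addA sect_addC sect_add0 sect_addN.
Fact sect_scaleA a b s : sect_scale a (sect_scale b s) = sect_scale (a * b) s.
Proof. by apply/sectP => y; rewrite !mksectE scalerA. Qed.
Fact sect_scale1 : left_id 1 sect_scale.
Proof. by move=> a; apply/sectP => y; rewrite !mksectE scale1r. Qed.
Fact sect_scaleDr : right_distributive sect_scale +%R.
Proof. by move=> a s t; apply/sectP => y; rewrite !mksectE scalerDr. Qed.
Fact sect_scaleDl s : {morph sect_scale^~ s : a b / a + b}.
Proof. by move=> a b; apply/sectP => y; rewrite !mksectE scalerDl. Qed.
HB.instance Definition _ := GRing.Zmodule_isLmodule.Build C sect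
  sect_scaleA sect_scale1 sect_scaleDr sect_scaleDl.
Lemma sectDE (s t : sect) y : (s + t) y = s y + t y. Proof. exact: mksectE. Qed.
Lemma sectZE a (s : sect) y : (a *: s) y = a *: s y. Proof. exact: mksectE. Qed.
Lemma sect0E y : (0 : sect) y = 0. Proof. exact: mksectE. Qed.

Import VectorInternalTheory.
Let T : finType := {y : Y & 'I_(dim (V y))}.
Fact sect_vect : Vector.axiom #|T| sect.
Proof.
pose fr (s : sect) : 'rV[C]_#|T| :=
  \row_k v2r (s (tag (enum_val k))) 0 (tagged (enum_val k)).
exists fr; first by move=> a s t; apply/rowP => k; rewrite !mxE sectDE sectZE linearP !mxE.
exists (fun r : 'rV[C]_#|T| => mksect (fun y => r2v (\row_i r 0 (enum_rank (Tagged (fun y => 'I_(dim (V y))) i))))) => [s|r].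
  apply/sectP => y; rewrite mksectE; apply: (canLR v2rK); apply/rowP => i.
  by rewrite !mxE enum_rankK.
apply/rowP => k; rewrite !mxE mksectE r2vK mxE; congr (r 0 _).
by apply: (canLR enum_valK); case: (enum_val k).
Qed.
HB.instance Definition _ := Lmodule_hasFinDim.Build C sect sect_vect.
End Sections.

Section DirectSum.
Variables (C : numClosedFieldType) (Y : finType) (k : Y -> C).
Hypothesis k0 : forall y, 0 < k y.
Variable V : Y -> hilb C.
Definition dsum_ip (s t : sect V) : C := \sum_y k y * ip (s y) (t y).
Fact dsum_ip_scalar s : scalar (dsum_ip s).
Proof.
move=> a t u; rewrite /dsum_ip mulr_sumr -big_split; apply: eq_bigr => y _ /=.
by rewrite sectDE sectZE ipDr ipZr mulrDr mulrCA.
Qed.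
Fact dsum_ip_conj s t : dsum_ip t s = (dsum_ip s t)^*.
Proof.
rewrite /dsum_ip rmorph_sum; apply: eq_bigr => y _ /=.
by rewrite rmorphM /= -ip_conj (CrealP _)// gtr0_real.
Qed.
Fact dsum_ip_gt0 s : s != 0 -> 0 < dsum_ip s s.
Proof.
move=> s0; have ge y : 0 <= k y * ip (s y) (s y).
  have [->|n0] := eqVneq (s y) 0; first by rewrite ip0r mulr0.
  by rewrite mulr_ge0 ?ltW ?ip_gt0.
rewrite lt_def sumr_ge0 ?andbT //.
apply: contraNneq s0 => /eqP; rewrite psumr_eq0 // => /allP z.
apply/eqP/sectP => y; rewrite sect0E; apply/eqP; apply: contraT => n0.
by have := z y (mem_index_enum _); rewrite /= gt_eqF // mulr_gt0 ?ip_gt0.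
Qed.
Definition dsum : hilb C := Hilb dsum_ip_scalar dsum_ip_conj dsum_ip_gt0.
End DirectSum.

Definition bilin (C : numClosedFieldType) (V W U : lmodType C) (phi : V -> W -> U) : Prop :=
  (forall w, linear (phi^~ w)) /\ (forall v, linear (phi v)).

Section TensorLift.
Variables (C : numClosedFieldType) (V W : hilb C).

Fact tpure_bilin : bilin (@tpure C V W).
Proof.
split=> [w a v v'|v a w w']; apply/matrixP => i j; rewrite !mxE ipDr ipZr.
  by rewrite mulrDl mulrA.
by rewrite mulrDr mulrCA.
Qed.

Lemma tens_exp (t : tens V W) :
  t = \sum_i \sum_j t i j *: tpure (hbase i) (hbase j).
Proof.
apply/matrixP => i j; rewrite summxE (bigD1 i) //= summxE (bigD1 j) //= !mxE.
rewrite !hbase_on !eqxx !mulr1 !big1 ?addr0// => [i' ne|j' ne]; last first.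
  by rewrite !mxE !hbase_on eqxx [j == _]eq_sym (negPf ne) mul1r mulr0.
rewrite summxE big1// => j' _.
by rewrite !mxE !hbase_on [i == _]eq_sym (negPf ne) mul0r mulr0.
Qed.

Variable U : lmodType C.

(* Total in phi; it is the map induced by phi as soon as phi is bilinear. *)
Definition tlift (phi : V -> W -> U) (t : tens V W) : U :=
  \sum_i \sum_j t i j *: phi (hbase i) (hbase j).

Fact tlift_linear phi : linear (tlift phi).
Proof.
move=> a s t; rewrite /tlift scaler_sumr -big_split; apply: eq_bigr => i _ /=.
rewrite scaler_sumr -big_split; apply: eq_bigr => j _ /=.
by rewrite !mxE scalerDl scalerA.
Qed.
HB.instance Definition _ phi :=
  GRing.isLinear.Build C (tens V W) U _ (tlift phi) (tlift_linear phi).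

Lemma tlift_pure phi v w : bilin phi -> tlift phi (tpure v w) = phi v w.
Proof.
move=> [hl hr]; rewrite /tlift.
pose L w0 := GRing.isLinear.Build _ _ _ _ _ (hl w0).
pose l w0 : {linear V -> U} := HB.pack (phi^~ w0) (L w0).
pose R v0 := GRing.isLinear.Build _ _ _ _ _ (hr v0).
pose r v0 : {linear W -> U} := HB.pack (phi v0) (R v0).
rewrite -[RHS]/(l w v) [in RHS](hbase_exp v) linear_sum; apply: eq_bigr => i _.
rewrite linearZ /= -[phi _ w]/(r (hbase i) w) [in RHS](hbase_exp w) linear_sum.
rewrite scaler_sumr; apply: eq_bigr => j _.
by rewrite linearZ /= !mxE scalerA.
Qed.
End TensorLift.

Section ConvFibre.
Variables (C : numClosedFieldType) (Y : finType) (k : Y -> C).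
Hypothesis k0 : forall y, 0 < k y.
Variables V W : Y -> hilb C.

(* Sections of V y (x) W y, the y-component of the inner product having weight k y. *)
Definition cfib : hilb C := dsum k0 (fun y => tens (V y) (W y)).

Definition cinj y (t : tens (V y) (W y)) : cfib :=
  mksect (@dfwith Y (fun z => tens (V z) (W z)) (fun=> 0) y t).
Definition cpure y (v : V y) (w : W y) : cfib := cinj (tpure v w).

Fact cinj_linear y : linear (@cinj y).
Proof.
move=> a s t; apply/sectP => z; rewrite sectDE sectZE !mksectE.
have [<-|ne] := eqVneq y z; first by rewrite !dfwith_in.
by rewrite !dfwith_out// scaler0 addr0.
Qed.
HB.instance Definition _ y := GRing.isLinear.Build C _ cfib _ (@cinj y) (@cinj_linear y).

Lemma cinj_exp (s : cfib) : s = \sum_y cinj (s y).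
Proof.
have e (F : Y -> cfib) z : (\sum_y F y) z = \sum_y F y z.
  by elim/big_rec2: _ => [|y a b _ <-]; rewrite ?sect0E ?sectDE.
apply/sectP => y; rewrite e (bigD1 y) //= !mksectE dfwith_in big1 ?addr0//.
by move=> z ne; rewrite mksectE dfwith_out.
Qed.

Fact cpure_bilin y : bilin (@cpure y).
Proof.
have [l r] := tpure_bilin (V y) (W y).
by split=> [w a v v'|v a w w']; rewrite /cpure ?l ?r linearP.
Qed.

Section Lift.
Variable U : vectType C.
Definition clift_fun (phi : forall y, V y -> W y -> U) (s : cfib) : U :=
  \sum_y tlift (@phi y) (s y).
Fact clift_fun_linear phi : linear (clift_fun phi).
Proof.
move=> a s t; rewrite /clift_fun scaler_sumr -big_split; apply: eq_bigr => y _ /=.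
by rewrite sectDE sectZE linearP.
Qed.
HB.instance Definition _ phi :=
  GRing.isLinear.Build C cfib U _ (clift_fun phi) (clift_fun_linear phi).
Definition clift (phi : forall y, V y -> W y -> U) : 'Hom(cfib, U) :=
  linfun (clift_fun phi).

Lemma clift_pure (phi : forall y, V y -> W y -> U) y v w :
  (forall y, bilin (@phi y)) -> clift phi (cpure v w) = phi y v w.
Proof.
move=> b; rewrite lfunE /= /clift_fun (bigD1 y)//= big1 => [|z ne].
  by rewrite addr0 mksectE dfwith_in tlift_pure.
by rewrite mksectE dfwith_out 1?eq_sym// raddf0.
Qed.

Lemma clift_lin a (phi psi : forall y, V y -> W y -> U) s :
  clift (fun y v w => a *: phi y v w + psi y v w) s =
  a *: clift phi s + clift psi s.
Proof.
rewrite !lfunE /= /clift_fun scaler_sumr -big_split; apply: eq_bigr => y _ /=.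
rewrite /tlift scaler_sumr -big_split; apply: eq_bigr => i _ /=.
rewrite scaler_sumr -big_split; apply: eq_bigr => j _ /=.
by rewrite scalerDr !scalerA mulrC.
Qed.

Lemma eq_clift (phi psi : forall y, V y -> W y -> U) :
  (forall y v w, phi y v w = psi y v w) -> clift phi = clift psi.
Proof. by move=> e; congr clift; do 3!apply: functional_extensionality_dep => ?; exact: e. Qed.

Lemma cext (f g : 'Hom(cfib, U)) :
  (forall y v w, f (@cpure y v w) = g (cpure v w)) -> f = g.
Proof.
move=> e; apply/lfunP => s; rewrite (cinj_exp s) !linear_sum; apply: eq_bigr => y _.
rewrite (tens_exp (s y)) !linear_sum; apply: eq_bigr => i _.
rewrite !linear_sum; apply: eq_bigr => j _.
by rewrite !linearZ /= -[cinj _]/(cpure _ _) e.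
Qed.
End Lift.

Section Pure.
Variables (y : Y).
Variables (v : V y) (w : W y).
HB.instance Definition _ := GRing.isLinear.Build C _ cfib _ (@cpure y v) ((cpure_bilin y).2 v).
Definition cpureL_fun (w : W y) (v : V y) := cpure v w.
Fact cpureL_linear : linear (cpureL_fun w). Proof. exact: (cpure_bilin y).1. Qed.
HB.instance Definition _ := GRing.isLinear.Build C _ cfib _ (cpureL_fun w) cpureL_linear.
Definition cpureL : 'Hom(V y, cfib) := linfun (cpureL_fun w).
Definition cpureR : 'Hom(W y, cfib) := linfun (@cpure y v).
Lemma cpureLE v' : cpureL v' = cpure v' w. Proof. by rewrite lfunE. Qed.
Lemma cpureRE w' : cpureR w' = cpure v w'. Proof. by rewrite lfunE. Qed.
End Pure.

Lemma ip_cpure y (v v' : V y) (w w' : W y) :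
  ip (cpure v w) (cpure v' w') = k y * (ip v v' * ip w w').
Proof.
rewrite -ip_tpure /= /dsum_ip (bigD1 y)//= big1 ?addr0 => [|z ne].
  by rewrite !mksectE !dfwith_in.
by rewrite !mksectE !dfwith_out 1?eq_sym//= [mx_ip _ _](@ip0r _ (tens (V z) (W z)) 0) mulr0.
Qed.
End ConvFibre.
Arguments cinj {C Y k k0 V W y}.
Arguments cpure {C Y k k0 V W y}.
Arguments cpureL {C Y k k0 V W y}.
Arguments cpureR {C Y k k0 V W y}.
Arguments clift {C Y k k0 V W U}.
Arguments clift_fun {C Y k k0 V W U}.

Reserved Notation "g \o1 f" (at level 40, left associativity).
Reserved Notation "b \v a" (at level 50, left associativity).
Reserved Notation "b \h a" (at level 40, left associativity).

(* Weak 2-categories.  c1 g f is the composite "g after f" of 1-morphisms, vc and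
   hc are the vertical and horizontal composites of 2-morphisms, and asoI, luI,
   ruI are the inverses of the associator and of the unitors. *)
Record bicat := Bicat {
  ob :> Type;
  mor : ob -> ob -> Type;
  cell : forall a b : ob, mor a b -> mor a b -> Type;
  id2 : forall (a b : ob) (f : mor a b), cell f f;
  vc : forall (a b : ob) (f g h : mor a b), cell g h -> cell f g -> cell f h;
  id1 : forall a : ob, mor a a;
  c1 : forall a b c : ob, mor b c -> mor a b -> mor a c;
  hc : forall (a b c : ob) (g g' : mor b c) (f f' : mor a b),
    cell g g' -> cell f f' -> cell (c1 g f) (c1 g' f');
  aso : forall (a b c d : ob) (h : mor c d) (g : mor b c) (f : mor a b),
    cell (c1 (c1 h g) f) (c1 h (c1 g f));
  asoI : forall (a b c d : ob) (h : mor c d) (g : mor b c) (f : mor a b),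
    cell (c1 h (c1 g f)) (c1 (c1 h g) f);
  lu : forall (a b : ob) (f : mor a b), cell (c1 (id1 b) f) f;
  luI : forall (a b : ob) (f : mor a b), cell f (c1 (id1 b) f);
  ru : forall (a b : ob) (f : mor a b), cell (c1 f (id1 a)) f;
  ruI : forall (a b : ob) (f : mor a b), cell f (c1 f (id1 a));
  vcA : forall (a b : ob) (f g h k : mor a b) (t : cell h k) (s : cell g h) (r : cell f g),
    vc t (vc s r) = vc (vc t s) r;
  vc1l : forall (a b : ob) (f g : mor a b) (s : cell f g), vc (id2 g) s = s;
  vc1r : forall (a b : ob) (f g : mor a b) (s : cell f g), vc s (id2 f) = s;
  hc_id : forall (a b c : ob) (g : mor b c) (f : mor a b),
    hc (id2 g) (id2 f) = id2 (c1 g f);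
  hc_vc : forall (a b c : ob) (g g' g'' : mor b c) (f f' f'' : mor a b)
      (t' : cell g' g'') (t : cell g g') (s' : cell f' f'') (s : cell f f'),
    hc (vc t' t) (vc s' s) = vc (hc t' s') (hc t s);
  aso_nat : forall (a b c d : ob) (h h' : mor c d) (g g' : mor b c) (f f' : mor a b)
      (t : cell h h') (s : cell g g') (r : cell f f'),
    vc (aso h' g' f') (hc (hc t s) r) = vc (hc t (hc s r)) (aso h g f);
  lu_nat : forall (a b : ob) (f f' : mor a b) (s : cell f f'),
    vc (lu f') (hc (id2 (id1 b)) s) = vc s (lu f);
  ru_nat : forall (a b : ob) (f f' : mor a b) (s : cell f f'),
    vc (ru f') (hc s (id2 (id1 a))) = vc s (ru f);
  asoK : forall (a b c d : ob) (h : mor c d) (g : mor b c) (f : mor a b),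
    vc (asoI h g f) (aso h g f) = id2 _;
  asoIK : forall (a b c d : ob) (h : mor c d) (g : mor b c) (f : mor a b),
    vc (aso h g f) (asoI h g f) = id2 _;
  luK : forall (a b : ob) (f : mor a b), vc (luI f) (lu f) = id2 _;
  luIK : forall (a b : ob) (f : mor a b), vc (lu f) (luI f) = id2 _;
  ruK : forall (a b : ob) (f : mor a b), vc (ruI f) (ru f) = id2 _;
  ruIK : forall (a b : ob) (f : mor a b), vc (ru f) (ruI f) = id2 _;
  pentagon : forall (a b c d e : ob) (k : mor d e) (h : mor c d) (g : mor b c) (f : mor a b),
    vc (aso k h (c1 g f)) (aso (c1 k h) g f) =
    vc (vc (hc (id2 k) (aso h g f)) (aso k (c1 h g) f)) (hc (aso k h g) (id2 f));
  triangle : forall (a b c : ob) (g : mor b c) (f : mor a b),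
    vc (hc (id2 g) (lu f)) (aso g (id1 b) f) = hc (ru g) (id2 f) }.

Arguments id1 {_} a.

Section FinSpaces.
Variable C : numClosedFieldType.

Record finspace := FinSpace {
  pt :> finType;
  wt : pt -> C;
  wt_gt0 : forall x, 0 < wt x }.

(* E y x is the fibre <y|E|x>. *)
Definition bundle (X Y : finspace) := Y -> X -> hilb C.
Definition bmap (X Y : finspace) (E F : bundle X Y) :=
  forall y x, 'Hom(E y x, F y x).

Fact wtV_gt0 (Y : finspace) (y : Y) : 0 < (wt y)^-1.
Proof. by rewrite invr_gt0 wt_gt0. Qed.

Definition bcomp (X Y Z : finspace) (F : bundle Y Z) (E : bundle X Y) : bundle X Z :=
  fun z x => cfib (@wtV_gt0 Y) (fun y => F z y) (fun y => E y x).

Definition bpure (X Y Z : finspace) (F : bundle Y Z) (E : bundle X Y) z x y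
    (v : F z y) (w : E y x) : bcomp F E z x := cpure v w.
Definition blift (X Y Z : finspace) (F : bundle Y Z) (E : bundle X Y) z x
    (U : hilb C) (phi : forall y, F z y -> E y x -> U) :
  'Hom(bcomp F E z x, U) := clift phi.

Section Scaled.
Variables (V : hilb C) (k : C) (k0 : 0 < k).
Definition scale_ip (u v : V) := k * ip u v.
Fact scale_ip_scalar u : scalar (scale_ip u).
Proof. by move=> a v w; rewrite /scale_ip ipDr ipZr mulrDr mulrCA. Qed.
Fact scale_ip_conj u v : scale_ip v u = (scale_ip u v)^*.
Proof. by rewrite /scale_ip rmorphM /= -ip_conj (CrealP _)// gtr0_real. Qed.
Fact scale_ip_gt0 u : u != 0 -> 0 < scale_ip u u.
Proof. by move=> u0; rewrite mulr_gt0 ?ip_gt0. Qed.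
Definition scale_hilb : hilb C := Hilb scale_ip_scalar scale_ip_conj scale_ip_gt0.
End Scaled.

(* 'rV_(x == y) has dimension 1 if x = y and 0 otherwise; bid1 x is the element
   1 of the diagonal fibre over x, and bid_sc u is the coordinate of u. *)
Definition bid (X : finspace) : bundle X X :=
  fun y x => scale_hilb (mx_hilb C 1 (x == y)) (wt_gt0 x).

Arguments bid : clear implicits.
Definition bid_sc (X : finspace) (y x : X) (u : bid X y x) : C :=
  \sum_i (u : 'rV[C]_(x == y)) 0 i.
Fact bid_sc_scalar (X : finspace) (y x : X) : scalar (@bid_sc X y x).
Proof.
move=> a u v; rewrite /bid_sc mulr_sumr -big_split; apply: eq_bigr => i _.
by rewrite !mxE.
Qed.
Definition bid1 (X : finspace) (x : X) : bid X x x := const_mx 1.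

Section Cells.
Variables X Y Z T : finspace.

Definition bmap_id (E : bundle X Y) : bmap E E := fun y x => \1%VF.
Definition bmap_vc (E F G : bundle X Y) (g : bmap F G) (f : bmap E F) : bmap E G :=
  fun y x => (g y x \o f y x)%VF.

Lemma bmapP (E F : bundle X Y) (f g : bmap E F) :
  (forall y x, f y x = g y x) -> f = g.
Proof. by move=> e; do 2!apply: functional_extensionality_dep => ?; exact: e. Qed.

Definition bmap_hc (F F' : bundle Y Z) (E E' : bundle X Y)
    (g : bmap F F') (f : bmap E E') : bmap (bcomp F E) (bcomp F' E') :=
  fun z x => blift (fun y v w => bpure (g z y v) (f y x w)).

Definition basso (G : bundle Z T) (F : bundle Y Z) (E : bundle X Y) :
    bmap (bcomp (bcomp G F) E) (bcomp G (bcomp F E)) :=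
  fun t x => blift (fun y (s : bcomp G F t y) (u : E y x) =>
    blift (fun z w v => bpure w (bpure v u)) s).

Definition bassoI (G : bundle Z T) (F : bundle Y Z) (E : bundle X Y) :
    bmap (bcomp G (bcomp F E)) (bcomp (bcomp G F) E) :=
  fun t x => blift (fun z (w : G t z) (s : bcomp F E z x) =>
    blift (fun y v u => bpure (bpure w v) u) s).

(* The components of s away from the diagonal lie in zero spaces, so that the
   unitors only involve the diagonal component, on which u (x) v |-> u v. *)
Definition blu_fun (E : bundle X Y) y x (s : bcomp (bid Y) E y x) : E y x :=
  tlift (fun (u : bid Y y y) (v : E y x) => bid_sc u *: v) (s y).
Fact blu_linear (E : bundle X Y) y x : linear (@blu_fun E y x).
Proof. by move=> a s t; rewrite /blu_fun sectDE sectZE linearP. Qed.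
HB.instance Definition _ E y x := GRing.isLinear.Build C _ _ _ _ (@blu_linear E y x).
Definition blu (E : bundle X Y) : bmap (bcomp (bid Y) E) E :=
  fun y x => linfun (@blu_fun E y x).

Definition bru_fun (E : bundle X Y) y x (s : bcomp E (bid X) y x) : E y x :=
  tlift (fun (v : E y x) (u : bid X x x) => bid_sc u *: v) (s x).
Fact bru_linear (E : bundle X Y) y x : linear (@bru_fun E y x).
Proof. by move=> a s t; rewrite /bru_fun sectDE sectZE linearP. Qed.
HB.instance Definition _ E y x := GRing.isLinear.Build C _ _ _ _ (@bru_linear E y x).
Definition bru (E : bundle X Y) : bmap (bcomp E (bid X)) E :=
  fun y x => linfun (@bru_fun E y x).

Definition bluI (E : bundle X Y) : bmap E (bcomp (bid Y) E) :=
  fun y x => linfun (bpure (bid1 y)).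

Definition bruI (E : bundle X Y) : bmap E (bcomp E (bid X)) :=
  fun y x => linfun (fun v : E y x => bpure v (bid1 x)).

End Cells.

Lemma linear_fZ (V W : lmodType C) (f : V -> W) (lf : linear f) a v :
  f (a *: v) = a *: f v.
Proof.
pose f' : {linear V -> W} := HB.pack f (GRing.isLinear.Build _ _ _ _ _ lf).
by have := linearZ_LR f' a v.
Qed.

Section Eval.
Variables X Y Z T : finspace.
Implicit Types (E : bundle X Y) (F : bundle Y Z) (G : bundle Z T).

Fact bpure_bilin F E z x y : bilin (@bpure X Y Z F E z x y).
Proof. exact: cpure_bilin. Qed.

Lemma bpureDl F E z x y a (v v' : F z y) (w : E y x) :
  bpure (a *: v + v') w = a *: bpure v w + bpure v' w.
Proof. exact: (bpure_bilin _ _ _ _ _).1. Qed.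

Lemma bpureDr F E z x y a (v : F z y) (w w' : E y x) :
  bpure v (a *: w + w') = a *: bpure v w + bpure v w'.
Proof. exact: (bpure_bilin _ _ _ _ _).2. Qed.

Lemma bpureZl F E z x y a (v : F z y) (w : E y x) :
  bpure (a *: v) w = a *: bpure v w.
Proof. exact: (linear_fZ ((bpure_bilin _ _ _ _ _).1 w)). Qed.

Lemma bpureZr F E z x y a (v : F z y) (w : E y x) :
  bpure v (a *: w) = a *: bpure v w.
Proof. exact: (linear_fZ ((bpure_bilin _ _ _ _ _).2 v)). Qed.

Lemma bpure0l F E z x y (w : E y x) : bpure (0 : F z y) w = 0 :> bcomp F E z x.
Proof. by have := bpureZl 0 (0 : F z y) w; rewrite !scale0r. Qed.

Lemma bpure0r F E z x y (v : F z y) : bpure v (0 : E y x) = 0 :> bcomp F E z x.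
Proof. by have := bpureZr 0 v (0 : E y x); rewrite !scale0r. Qed.

Lemma blift_pure F E z x (U : hilb C) (phi : forall y, F z y -> E y x -> U) y
    (v : F z y) (w : E y x) :
  (forall y, bilin (@phi y)) -> blift phi (bpure v w) = phi y v w.
Proof. exact: clift_pure. Qed.

Lemma bext F E z x (U : hilb C) (f g : 'Hom(bcomp F E z x, U)) :
  (forall y (v : F z y) (w : E y x), f (bpure v w) = g (bpure v w)) -> f = g.
Proof. exact: cext. Qed.

Lemma bext_fun F E z x (U : hilb C) (f g : bcomp F E z x -> U) :
  linear f -> linear g ->
  (forall y (v : F z y) (w : E y x), f (bpure v w) = g (bpure v w)) -> f =1 g.
Proof.
move=> lf lg e.
pose f' : {linear bcomp F E z x -> U} := HB.pack f (GRing.isLinear.Build _ _ _ _ _ lf).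
pose g' : {linear bcomp F E z x -> U} := HB.pack g (GRing.isLinear.Build _ _ _ _ _ lg).
have {}e : linfun f' = linfun g' by apply: bext => y v w; rewrite !lfunE; exact: e.
by move=> s; have := congr1 (fun h : 'Hom(_, _) => h s) e; rewrite !lfunE.
Qed.

Lemma bmap_hcE F F' E E' (g : bmap F F') (f : bmap E E') z x y
    (v : F z y) (w : E y x) :
  bmap_hc g f z x (bpure v w) = bpure (g z y v) (f y x w).
Proof.
by apply: blift_pure => y'; split=> [u a s t|u a s t]; rewrite linearP ?bpureDl ?bpureDr.
Qed.

End Eval.

Section Eval2.
Variables X Y Z T : finspace.
Implicit Types (E : bundle X Y) (F : bundle Y Z) (G : bundle Z T).

Lemma bassoE G F E t x z y (w : G t z) (v : F z y) (u : E y x) :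
  basso G F E t x (bpure (bpure w v) u) = bpure w (bpure v u).
Proof.
rewrite /basso blift_pure => [|y']; last first.
  split=> [u' a s s'|s a u' u'']; first by rewrite linearP.
  rewrite /blift -clift_lin; congr (clift _ _).
  do 3!apply: functional_extensionality_dep => ?.
  by rewrite -bpureDr -bpureDr.
by rewrite blift_pure // => z'; split=> [v' a s s'|s a s' s''];
   rewrite !(bpureDl, bpureDr).
Qed.

Lemma bassoIE G F E t x z y (w : G t z) (v : F z y) (u : E y x) :
  bassoI G F E t x (bpure w (bpure v u)) = bpure (bpure w v) u.
Proof.
rewrite /bassoI blift_pure => [|z']; last first.
  split=> [s a w' w''|w' a s s']; last by rewrite linearP.
  rewrite /blift -clift_lin; congr (clift _ _).
  do 3!apply: functional_extensionality_dep => ?.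
  by rewrite -bpureDl -bpureDl.
by rewrite blift_pure // => y'; split=> [v' a s s'|s a s' s''];
   rewrite !(bpureDl, bpureDr).
Qed.

Lemma bid0 (y y' : Y) (u : bid Y y y') : y != y' -> u = 0.
Proof.
rewrite eq_sym => /negPf ne; apply/(@rowP _ _ (u : 'rV[C]_(y' == y))) => i.
by exfalso; case: i => i; rewrite ne ltn0.
Qed.

Lemma bidE (y : Y) (u : bid Y y y) : u = bid_sc u *: bid1 y.
Proof.
apply/(@rowP _ _ (u : 'rV[C]_(y == y))) => i; rewrite !mxE mulr1 /bid_sc.
have h : forall j, j = i.
  by case: i => i hi [j hj]; apply/val_inj => /=; move: hi hj; rewrite eqxx; case: i j => [|i] // [|j].
by rewrite (bigD1 i)//= big1 ?addr0// => j; rewrite (h j) eqxx.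
Qed.

Lemma bid_sc1 (y : Y) : bid_sc (bid1 y) = 1.
Proof.
rewrite /bid_sc (eq_bigr (fun=> 1)) => [|i _]; last by rewrite mxE.
by rewrite sumr_const card_ord eqxx.
Qed.

Lemma bluE E y x (u : bid Y y y) (v : E y x) :
  blu E y x (bpure u v) = bid_sc u *: v.
Proof.
rewrite lfunE /= /blu_fun mksectE dfwith_in tlift_pure//.
split=> [w a s t|w a s t]; last by rewrite scalerDr !scalerA mulrC.
by rewrite bid_sc_scalar scalerDl scalerA.
Qed.

Lemma bruE E y x (u : bid X x x) (v : E y x) :
  bru E y x (bpure v u) = bid_sc u *: v.
Proof.
rewrite lfunE /= /bru_fun mksectE dfwith_in tlift_pure//.
split=> [w a s t|w a s t]; first by rewrite scalerDr !scalerA mulrC.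
by rewrite bid_sc_scalar scalerDl scalerA.
Qed.

Lemma bluIE E y x (v : E y x) : bluI E y x v = bpure (bid1 y) v.
Proof.
pose l := GRing.isLinear.Build _ _ _ _ _ ((bpure_bilin (bid Y) E y x y).2 (bid1 y)).
by pose f : {linear E y x -> _} := HB.pack (bpure (bid1 y)) l; exact: (lfunE f).
Qed.

Lemma bruIE E y x (v : E y x) : bruI E y x v = bpure v (bid1 x).
Proof.
pose l := GRing.isLinear.Build _ _ _ _ _ ((bpure_bilin E (bid X) y x x).1 (bid1 x)).
by pose f : {linear E y x -> _} := HB.pack (fun v : E y x => bpure v (bid1 x)) l; exact: (lfunE f).
Qed.

End Eval2.
End FinSpaces.


Arguments bid {C} X.
Arguments bid1 {C X} x.
Section FinSpacesLaws.
Variable C : numClosedFieldType.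
Implicit Types X Y Z T S : finspace C.

Lemma bextL X Y Z T (G : bundle Z T) (F : bundle Y Z) (E : bundle X Y) t x
    (U : hilb C) (f g : 'Hom(bcomp (bcomp G F) E t x, U)) :
  (forall z y (w : G t z) (v : F z y) (u : E y x),
    f (bpure (bpure w v) u) = g (bpure (bpure w v) u)) -> f = g.
Proof.
move=> e; apply: bext => y s u; move: s.
by apply: bext_fun => [a s s'|a s s'|z w v]; rewrite ?bpureDl ?linearP.
Qed.

Lemma bextR X Y Z T (G : bundle Z T) (F : bundle Y Z) (E : bundle X Y) t x
    (U : hilb C) (f g : 'Hom(bcomp G (bcomp F E) t x, U)) :
  (forall z y (w : G t z) (v : F z y) (u : E y x),
    f (bpure w (bpure v u)) = g (bpure w (bpure v u))) -> f = g.
Proof.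
move=> e; apply: bext => z w s; move: s.
by apply: bext_fun => [a s s'|a s s'|y v u]; rewrite ?bpureDr ?linearP.
Qed.

Lemma bextL4 X Y Z T S (K : bundle T S) (G : bundle Z T) (F : bundle Y Z) (E : bundle X Y) s x
    (U : hilb C) (f g : 'Hom(bcomp (bcomp (bcomp K G) F) E s x, U)) :
  (forall t z y (k : K s t) (w : G t z) (v : F z y) (u : E y x),
    f (bpure (bpure (bpure k w) v) u) = g (bpure (bpure (bpure k w) v) u)) -> f = g.
Proof.
move=> e; apply: bextL => z y r v u; move: r.
by apply: bext_fun => [a r r'|a r r'|t k w]; rewrite ?bpureDl ?linearP.
Qed.

Let vcE X Y (E F G : bundle X Y) (g : bmap F G) (f : bmap E F) y x v :
  bmap_vc g f y x v = g y x (f y x v).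
Proof. exact: comp_lfunE. Qed.
Let idE X Y (E : bundle X Y) y x v : bmap_id E y x v = v.
Proof. exact: id_lfunE. Qed.

Lemma bid_hom0 X Y (E : bundle X Y) y y' x (u : bid Y y y') (v : E y' x) :
  y != y' -> bpure u v = 0 :> bcomp (bid Y) E y x.
Proof. by move=> ne; rewrite (bid0 u ne); exact: bpure0l. Qed.
Lemma bid_hom0r X Y (E : bundle X Y) y x' x (u : bid X x' x) (v : E y x') :
  x' != x -> bpure v u = 0 :> bcomp E (bid X) y x.
Proof. by move=> ne; rewrite (bid0 u ne); exact: bpure0r. Qed.

Fact fin_vcA X Y (E F G H : bundle X Y) (h : bmap G H) (g : bmap F G) (f : bmap E F) :
  bmap_vc h (bmap_vc g f) = bmap_vc (bmap_vc h g) f.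
Proof. by apply: bmapP => y x; rewrite /bmap_vc comp_lfunA. Qed.
Fact fin_vc1l X Y (E F : bundle X Y) (f : bmap E F) : bmap_vc (bmap_id F) f = f.
Proof. by apply: bmapP => y x; rewrite /bmap_vc comp_lfun1l. Qed.
Fact fin_vc1r X Y (E F : bundle X Y) (f : bmap E F) : bmap_vc f (bmap_id E) = f.
Proof. by apply: bmapP => y x; rewrite /bmap_vc comp_lfun1r. Qed.
Fact fin_hc_id X Y Z (F : bundle Y Z) (E : bundle X Y) :
  bmap_hc (bmap_id F) (bmap_id E) = bmap_id (bcomp F E).
Proof. by apply: bmapP => z x; apply: bext => y v w; rewrite bmap_hcE !idE. Qed.
Fact fin_hc_vc X Y Z (F F' F'' : bundle Y Z) (E E' E'' : bundle X Y)
    (g' : bmap F' F'') (g : bmap F F') (f' : bmap E' E'') (f : bmap E E') :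
  bmap_hc (bmap_vc g' g) (bmap_vc f' f) = bmap_vc (bmap_hc g' f') (bmap_hc g f).
Proof.
by apply: bmapP => z x; apply: bext => y v w; rewrite vcE !bmap_hcE !vcE.
Qed.
Fact fin_aso_nat X Y Z T (G G' : bundle Z T) (F F' : bundle Y Z) (E E' : bundle X Y)
    (h : bmap G G') (g : bmap F F') (f : bmap E E') :
  bmap_vc (basso G' F' E') (bmap_hc (bmap_hc h g) f) =
  bmap_vc (bmap_hc h (bmap_hc g f)) (basso G F E).
Proof.
apply: bmapP => t x; apply: bextL => z y w v u.
by rewrite !vcE !(bmap_hcE, bassoE).
Qed.
Fact fin_lu_nat X Y (E E' : bundle X Y) (f : bmap E E') :
  bmap_vc (blu E') (bmap_hc (bmap_id (bid Y)) f) = bmap_vc f (blu E).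
Proof.
apply: bmapP => y x; apply: bext => y' u v; rewrite !vcE.
have [e|ne] := eqVneq y y'; last by rewrite bid_hom0 ?linear0.
by case: _ / e in u v *; rewrite bmap_hcE !bluE idE linearZ.
Qed.
Fact fin_ru_nat X Y (E E' : bundle X Y) (f : bmap E E') :
  bmap_vc (bru E') (bmap_hc f (bmap_id (bid X))) = bmap_vc f (bru E).
Proof.
apply: bmapP => y x; apply: bext => x' v u; rewrite !vcE.
have [e|ne] := eqVneq x' x; last by rewrite bid_hom0r ?linear0.
by case: _ / e in u v *; rewrite bmap_hcE !bruE idE linearZ.
Qed.
Fact fin_asoK X Y Z T (G : bundle Z T) (F : bundle Y Z) (E : bundle X Y) :
  bmap_vc (bassoI G F E) (basso G F E) = bmap_id _.
Proof.
apply: bmapP => t x; apply: bextL => z y w v u.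
by rewrite vcE idE bassoE bassoIE.
Qed.
Fact fin_asoIK X Y Z T (G : bundle Z T) (F : bundle Y Z) (E : bundle X Y) :
  bmap_vc (basso G F E) (bassoI G F E) = bmap_id _.
Proof.
apply: bmapP => t x; apply: bextR => z y w v u.
by rewrite vcE idE bassoIE bassoE.
Qed.
Fact fin_luK X Y (E : bundle X Y) : bmap_vc (bluI E) (blu E) = bmap_id _.
Proof.
apply: bmapP => y x; apply: bext => y' u v; rewrite vcE idE.
have [e|ne] := eqVneq y y'; last by rewrite bid_hom0 ?linear0.
by case: _ / e in u v *; rewrite bluE bluIE bpureZr -bpureZl -bidE.
Qed.
Fact fin_luIK X Y (E : bundle X Y) : bmap_vc (blu E) (bluI E) = bmap_id _.
Proof.
by apply: bmapP => y x; apply/lfunP => v; rewrite vcE idE bluIE bluE bid_sc1 scale1r.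
Qed.
Fact fin_ruK X Y (E : bundle X Y) : bmap_vc (bruI E) (bru E) = bmap_id _.
Proof.
apply: bmapP => y x; apply: bext => x' v u; rewrite vcE idE.
have [e|ne] := eqVneq x' x; last by rewrite bid_hom0r ?linear0.
by case: _ / e in u v *; rewrite bruE bruIE bpureZl -bpureZr -bidE.
Qed.
Fact fin_ruIK X Y (E : bundle X Y) : bmap_vc (bru E) (bruI E) = bmap_id _.
Proof.
by apply: bmapP => y x; apply/lfunP => v; rewrite vcE idE bruIE bruE bid_sc1 scale1r.
Qed.
Fact fin_pentagon X Y Z T S (K : bundle T S) (G : bundle Z T) (F : bundle Y Z) (E : bundle X Y) :
  bmap_vc (basso K G (bcomp F E)) (basso (bcomp K G) F E) =
  bmap_vc (bmap_vc (bmap_hc (bmap_id K) (basso G F E)) (basso K (bcomp G F) E))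
    (bmap_hc (basso K G F) (bmap_id E)).
Proof.
apply: bmapP => s x; apply: bextL4 => t z y k w v u.
by rewrite !vcE !(bassoE, bmap_hcE, idE).
Qed.
Fact fin_triangle X Y Z (F : bundle Y Z) (E : bundle X Y) :
  bmap_vc (bmap_hc (bmap_id F) (blu E)) (basso F (bid Y) E) =
  bmap_hc (bru F) (bmap_id E).
Proof.
apply: bmapP => z x; apply: bextL => y y' v u w; rewrite vcE bassoE !bmap_hcE !idE.
have [e|ne] := eqVneq y y'.
  by case: _ / e in u w *; rewrite bluE bruE bpureZl bpureZr.
by rewrite bid_hom0 // bid_hom0r // !linear0 bpure0l bpure0r.
Qed.

Definition FinSpaces : bicat :=
  @Bicat (finspace C) (@bundle C) (@bmap C) (@bmap_id C) (@bmap_vc C) (@bid C)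
    (@bcomp C) (@bmap_hc C) (@basso C) (@bassoI C) (@blu C) (@bluI C) (@bru C) (@bruI C)
    fin_vcA fin_vc1l fin_vc1r fin_hc_id fin_hc_vc fin_aso_nat fin_lu_nat fin_ru_nat
    fin_asoK fin_asoIK fin_luK fin_luIK fin_ruK fin_ruIK fin_pentagon fin_triangle.

End FinSpacesLaws.

Reserved Notation "f \oc g" (at level 40, left associativity).

Section TwoHilb.
Variable C : numClosedFieldType.

(* hcomp f g is the composite f after g, written fg in the axioms of an
   H*-category; hdag is the involution. *)
Record hstar := HStar {
  hobj :> Type;
  hom : hobj -> hobj -> hilb C;
  hid : forall x, hom x x;
  hcomp : forall x y z, hom y z -> hom x y -> hom x z;
  hdag : forall x y, hom x y -> hom y x;
  hcompA : forall x y z t (f : hom z t) (g : hom y z) (h : hom x y),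
    hcomp f (hcomp g h) = hcomp (hcomp f g) h;
  hcomp1l : forall x y (f : hom x y), hcomp (hid y) f = f;
  hcomp1r : forall x y (f : hom x y), hcomp f (hid x) = f;
  hcomp_bilin : forall x y z, bilin (@hcomp x y z);
  hdag_antilin : forall x y a (f g : hom x y),
    hdag (a *: f + g) = a^* *: hdag f + hdag g;
  hdagK : forall x y (f : hom x y), hdag (hdag f) = f;
  hdagM : forall x y z (f : hom y z) (g : hom x y),
    hdag (hcomp f g) = hcomp (hdag g) (hdag f);
  ip_hcompl : forall x y z (f : hom y z) (g : hom x y) (h : hom x z),
    ip (hcomp f g) h = ip g (hcomp (hdag f) h);
  ip_hcompr : forall x y z (f : hom y z) (g : hom x y) (h : hom x z),
    ip (hcomp f g) h = ip f (hcomp h (hdag g)) }.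

Local Notation "f \oc g" := (hcomp f g).

Section HStarNotions.
Variable H : hstar.

Definition has_direct_sums : Prop :=
  forall n (x : 'I_n -> H), exists (s : H)
    (inj : forall k, hom (x k) s) (prj : forall k, hom s (x k)),
    [/\ forall k, prj k \oc inj k = hid (x k),
        forall k l, k != l -> prj k \oc inj l = 0
      & \sum_k inj k \oc prj k = hid s].

Definition idempotents_split : Prop :=
  forall (x : H) (p : hom x x), p \oc p = p ->
  exists (y : H) (r : hom x y) (s : hom y x), r \oc s = hid y /\ s \oc r = p.

Definition cauchy_complete : Prop := has_direct_sums /\ idempotents_split.

Definition is_iso (x y : H) (f : hom x y) : Prop :=
  exists g : hom y x, g \oc f = hid x /\ f \oc g = hid y.
Definition isomorphic (x y : H) : Prop := exists f : hom x y, is_iso f.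

Definition is_mono (x y : H) (m : hom x y) : Prop :=
  forall z (f g : hom z x), m \oc f = m \oc g -> f = g.

(* Nonzero (an object is a zero object iff its identity vanishes), and with no
   subobjects other than zero and the whole object. *)
Definition is_simple (x : H) : Prop :=
  hid x != 0 /\
  forall y (m : hom y x), is_mono m -> m = 0 \/ is_iso m.
End HStarNotions.

(* Finite-dimensional marked 2-Hilbert spaces: mobj enumerates the marked simple
   objects, one in each isomorphism class of simple objects. *)
Record mark2hilb := Mark2Hilb {
  mcat :> hstar;
  mcauchy : cauchy_complete mcat;
  midx : finType;
  mobj : midx -> mcat;
  mobj_simple : forall i, is_simple (mobj i);
  mobj_cover : forall x, is_simple x -> exists i, isomorphic (mobj i) x;
  mobj_inj : forall i j, isomorphic (mobj i) (mobj j) -> i = j }.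

Definition scale_factor (H : mark2hilb) (i : midx H) : C :=
  ip (hid (mobj i)) (hid (mobj i)).
Fact scale_factor_gt0 (H : mark2hilb) (i : midx H) : 0 < scale_factor i.
Proof. by apply: ip_gt0; have [] := mobj_simple i. Qed.

Record sfun (H K : hstar) := SFun {
  sf0 :> H -> K;
  sf1 : forall x y, hom x y -> hom (sf0 x) (sf0 y);
  sf1_id : forall x, sf1 (hid x) = hid (sf0 x);
  sf1_comp : forall x y z (f : hom y z) (g : hom x y),
    sf1 (f \oc g) = sf1 f \oc sf1 g;
  sf1_linear : forall x y, linear (@sf1 x y);
  sf1_dag : forall x y (f : hom x y), sf1 (hdag f) = hdag (sf1 f) }.

Record ntrans (H K : hstar) (F G : sfun H K) := NTrans {
  nt :> forall x, hom (F x) (G x);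
  nt_nat : forall x y (f : hom x y), nt y \oc sf1 F f = sf1 G f \oc nt x }.

Lemma ntransP (H K : hstar) (F G : sfun H K) (s t : ntrans F G) :
  (forall x, s x = t x) -> s = t.
Proof.
case: s t => [s hs] [t ht] /= e.
have {}e : s = t by apply: functional_extensionality_dep.
by case: _ / e in ht *; congr NTrans; apply: Prop_irrelevance.
Qed.

Section Functors.
Variables H K L M : hstar.

Lemma hcompDl (x y z : H) a (f f' : hom y z) (g : hom x y) :
  (a *: f + f') \oc g = a *: (f \oc g) + f' \oc g.
Proof. exact: (hcomp_bilin x y z).1. Qed.
Lemma hcompDr (x y z : H) a (f : hom y z) (g g' : hom x y) :
  f \oc (a *: g + g') = a *: (f \oc g) + f \oc g'.
Proof. exact: (hcomp_bilin x y z).2. Qed.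

Definition sfun_id : sfun H H.
Proof. by exists id (fun _ _ => id). Defined.

Program Definition sfun_comp (G : sfun K L) (F : sfun H K) : sfun H L :=
  {| sf0 := fun x => G (F x); sf1 := fun x y f => sf1 G (sf1 F f) |}.
Next Obligation. by rewrite !sf1_id. Qed.
Next Obligation. by rewrite !sf1_comp. Qed.
Next Obligation. by move=> a f g; rewrite !sf1_linear. Qed.
Next Obligation. by rewrite !sf1_dag. Qed.

Program Definition nt_id (F : sfun H K) : ntrans F F := {| nt := fun x => hid (F x) |}.
Next Obligation. by rewrite hcomp1l hcomp1r. Qed.

Program Definition nt_vc (F G G' : sfun H K) (t : ntrans G G') (s : ntrans F G) :
  ntrans F G' := {| nt := fun x => t x \oc s x |}.
Next Obligation. by rewrite -hcompA nt_nat hcompA nt_nat hcompA. Qed.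

Program Definition nt_hc (G G' : sfun K L) (F F' : sfun H K)
    (t : ntrans G G') (s : ntrans F F') : ntrans (sfun_comp G F) (sfun_comp G' F') :=
  {| nt := fun x => t (F' x) \oc sf1 G (s x) |}.
Next Obligation. by rewrite /= -hcompA -sf1_comp (nt_nat s) sf1_comp hcompA (nt_nat t) hcompA. Qed.

Program Definition nt_lin a (F G : sfun H K) (s t : ntrans F G) : ntrans F G :=
  {| nt := fun x => a *: s x + t x |}.
Next Obligation.
rewrite (hcomp_bilin _ _ _).1 (hcomp_bilin _ _ _).2; congr (_ *: _ + _); exact: nt_nat.
Qed.
End Functors.

Program Definition nt_aso (H K L M : hstar) (E : sfun L M) (G : sfun K L) (F : sfun H K) :
    ntrans (sfun_comp (sfun_comp E G) F) (sfun_comp E (sfun_comp G F)) :=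
  {| nt := fun x => hid (E (G (F x))) |}.
Next Obligation. by rewrite hcomp1l hcomp1r. Qed.
Program Definition nt_asoI (H K L M : hstar) (E : sfun L M) (G : sfun K L) (F : sfun H K) :
    ntrans (sfun_comp E (sfun_comp G F)) (sfun_comp (sfun_comp E G) F) :=
  {| nt := fun x => hid (E (G (F x))) |}.
Next Obligation. by rewrite hcomp1l hcomp1r. Qed.
Program Definition nt_lu (H K : hstar) (F : sfun H K) : ntrans (sfun_comp (sfun_id K) F) F :=
  {| nt := fun x => hid (F x) |}.
Next Obligation. by rewrite hcomp1l hcomp1r. Qed.
Program Definition nt_luI (H K : hstar) (F : sfun H K) : ntrans F (sfun_comp (sfun_id K) F) :=
  {| nt := fun x => hid (F x) |}.
Next Obligation. by rewrite hcomp1l hcomp1r. Qed.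
Program Definition nt_ru (H K : hstar) (F : sfun H K) : ntrans (sfun_comp F (sfun_id H)) F :=
  {| nt := fun x => hid (F x) |}.
Next Obligation. by rewrite hcomp1l hcomp1r. Qed.
Program Definition nt_ruI (H K : hstar) (F : sfun H K) : ntrans F (sfun_comp F (sfun_id H)) :=
  {| nt := fun x => hid (F x) |}.
Next Obligation. by rewrite hcomp1l hcomp1r. Qed.

(* Composition of functors is strictly associative and unital up to the proof
   components, so all coherence 2-morphisms have identity components. *)
Program Definition TwoHilbM : bicat :=
  @Bicat mark2hilb (fun H K => sfun H K) (fun H K F G => ntrans F G)
    (fun H K F => nt_id F) (fun H K F G G' t s => nt_vc t s)
    (fun H => sfun_id H) (fun H K L G F => sfun_comp G F)
    (fun H K L G G' F F' t s => nt_hc t s)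
    (fun H K L M E G F => nt_aso E G F) (fun H K L M E G F => nt_asoI E G F)
    (fun H K F => nt_lu F) (fun H K F => nt_luI F)
    (fun H K F => nt_ru F) (fun H K F => nt_ruI F)
    _ _ _ _ _ _ _ _ _ _ _ _ _ _ _ _.
Next Obligation. by apply: ntransP => x; rewrite /= hcompA. Qed.
Next Obligation. by apply: ntransP => x; rewrite /= hcomp1l. Qed.
Next Obligation. by apply: ntransP => x; rewrite /= hcomp1r. Qed.
Next Obligation. by apply: ntransP => x; rewrite /= sf1_id hcomp1r. Qed.
Next Obligation.
apply: ntransP => x /=; rewrite sf1_comp -!hcompA; congr (_ \oc _).
by rewrite !hcompA nt_nat.
Qed.
Next Obligation.
by apply: ntransP => x /=; rewrite hcomp1l hcomp1r sf1_comp hcompA.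
Qed.
Next Obligation. by apply: ntransP => x /=; rewrite !hcomp1l hcomp1r. Qed.
Next Obligation. by apply: ntransP => x /=; rewrite !(sf1_id, hcomp1l, hcomp1r). Qed.
Next Obligation. by apply: ntransP => x /=; rewrite !(sf1_id, hcomp1l, hcomp1r). Qed.
Next Obligation. by apply: ntransP => x /=; rewrite !(sf1_id, hcomp1l, hcomp1r). Qed.
Next Obligation. by apply: ntransP => x /=; rewrite !(sf1_id, hcomp1l, hcomp1r). Qed.
Next Obligation. by apply: ntransP => x /=; rewrite !(sf1_id, hcomp1l, hcomp1r). Qed.
Next Obligation. by apply: ntransP => x /=; rewrite !(sf1_id, hcomp1l, hcomp1r). Qed.
Next Obligation. by apply: ntransP => x /=; rewrite !(sf1_id, hcomp1l, hcomp1r). Qed.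
Next Obligation. by apply: ntransP => x /=; rewrite !(sf1_id, hcomp1l, hcomp1r). Qed.
Next Obligation. by apply: ntransP => x /=; rewrite !(sf1_id, hcomp1l, hcomp1r). Qed.

Definition nt_ip (H K : mark2hilb) (F G : sfun H K) (s t : ntrans F G) : C :=
  \sum_(i : midx H) scale_factor i * ip (s (mobj i)) (t (mobj i)).
End TwoHilb.

Local Notation "g \o1 f" := (c1 g f).
Local Notation "t \v s" := (vc t s).
Local Notation "t \h s" := (hc t s).

Definition inv2 (B : bicat) (a b : B) (f g : mor a b) (s : cell f g) : Prop :=
  exists t : cell g f, t \v s = id2 f /\ s \v t = id2 g.

Definition equiv1 (B : bicat) (a b : B) (f : mor a b) : Prop :=
  exists (g : mor b a) (eta : cell (id1 a) (g \o1 f)) (eps : cell (f \o1 g) (id1 b)),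
    inv2 eta /\ inv2 eps.

(* The data of a weak 2-functor: psc is the compositor and psu the unit
   coherence; the laws, including invertibility of both, are is_weak2functor. *)
Record psfun (A B : bicat) := PsFun {
  ps0 :> A -> B;
  ps1 : forall a b : A, mor a b -> mor (ps0 a) (ps0 b);
  ps2 : forall (a b : A) (f g : mor a b), cell f g -> cell (ps1 f) (ps1 g);
  psc : forall (a b c : A) (g : mor b c) (f : mor a b),
    cell (ps1 g \o1 ps1 f) (ps1 (g \o1 f));
  psu : forall a : A, cell (id1 (ps0 a)) (ps1 (id1 a)) }.
Arguments psu {A B} p a.

Record is_weak2functor (A B : bicat) (F : psfun A B) : Prop := {
  ps2_id : forall (a b : A) (f : mor a b), ps2 F (id2 f) = id2 (ps1 F f);
  ps2_vc : forall (a b : A) (f g h : mor a b) (t : cell g h) (s : cell f g),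
    ps2 F (t \v s) = ps2 F t \v ps2 F s;
  psc_inv : forall (a b c : A) (g : mor b c) (f : mor a b), inv2 (psc F g f);
  psu_inv : forall a : A, inv2 (psu F a);
  psc_nat : forall (a b c : A) (g g' : mor b c) (f f' : mor a b)
      (t : cell g g') (s : cell f f'),
    psc F g' f' \v (ps2 F t \h ps2 F s) = ps2 F (t \h s) \v psc F g f;
  psc_aso : forall (a b c d : A) (h : mor c d) (g : mor b c) (f : mor a b),
    ps2 F (aso h g f) \v (psc F (h \o1 g) f \v (psc F h g \h id2 (ps1 F f))) =
    psc F h (g \o1 f) \v ((id2 (ps1 F h) \h psc F g f) \v
      aso (ps1 F h) (ps1 F g) (ps1 F f));
  psc_lu : forall (a b : A) (f : mor a b),
    ps2 F (lu f) \v (psc F (id1 b) f \v (psu F b \h id2 (ps1 F f))) = lu (ps1 F f);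
  psc_ru : forall (a b : A) (f : mor a b),
    ps2 F (ru f) \v (psc F f (id1 a) \v (id2 (ps1 F f) \h psu F a)) = ru (ps1 F f) }.

Definition psfun_id (A : bicat) : psfun A A :=
  {| ps0 := fun a => a;
     ps1 := fun a b f => f;
     ps2 := fun a b f g s => s;
     psc := fun a b c g f => id2 (g \o1 f);
     psu := fun a => id2 (id1 a) |}.

Definition psfun_comp (A B D : bicat) (G : psfun B D) (F : psfun A B) : psfun A D :=
  {| ps0 := fun a => G (F a);
     ps1 := fun a b f => ps1 G (ps1 F f);
     ps2 := fun a b f g s => ps2 G (ps2 F s);
     psc := fun a b c g f => ps2 G (psc F g f) \v psc G (ps1 F g) (ps1 F f);
     psu := fun a => ps2 G (psu F a) \v psu G (F a) |}.

Record pseudonat (A B : bicat) (F G : psfun A B) := Pseudonat {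
  pt0 :> forall a : A, mor (F a) (G a);
  pt1 : forall (a b : A) (f : mor a b),
    cell (ps1 G f \o1 pt0 a) (pt0 b \o1 ps1 F f);
  pt1_inv : forall (a b : A) (f : mor a b), inv2 (pt1 f);
  pt1_nat : forall (a b : A) (f f' : mor a b) (s : cell f f'),
    pt1 f' \v (ps2 G s \h id2 (pt0 a)) = (id2 (pt0 b) \h ps2 F s) \v pt1 f;
  pt1_comp : forall (a b c : A) (g : mor b c) (f : mor a b),
    pt1 (g \o1 f) \v (psc G g f \h id2 (pt0 a)) =
    (id2 (pt0 c) \h psc F g f) \v (aso (pt0 c) (ps1 F g) (ps1 F f) \v
     ((pt1 g \h id2 (ps1 F f)) \v (asoI (ps1 G g) (pt0 b) (ps1 F f) \v
      ((id2 (ps1 G g) \h pt1 f) \v aso (ps1 G g) (ps1 G f) (pt0 a)))));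
  pt1_id : forall a : A,
    pt1 (id1 a) \v (psu G a \h id2 (pt0 a)) =
    (id2 (pt0 a) \h psu F a) \v (ruI (pt0 a) \v lu (pt0 a)) }.

Definition is_pseudonat_equiv (A B : bicat) (F G : psfun A B) (t : pseudonat F G) : Prop :=
  forall a : A, equiv1 (t a).

Definition is_biequivalence (A B : bicat) (F : psfun A B) : Prop :=
  exists G : psfun B A, is_weak2functor G /\
    (exists t : pseudonat (psfun_id A) (psfun_comp G F), is_pseudonat_equiv t) /\
    (exists t : pseudonat (psfun_comp F G) (psfun_id B), is_pseudonat_equiv t).

Section Bracket.
Variable C : numClosedFieldType.

Definition bmap_adj (X Y : finspace C) (E F : bundle X Y) (f : bmap E F) : bmap F E :=
  fun y x => adj (f y x).
Definition bmap_unitary (X Y : finspace C) (E F : bundle X Y) (f : bmap E F) : Prop :=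
  bmap_vc (bmap_adj f) f = bmap_id E /\ bmap_vc f (bmap_adj f) = bmap_id F.

Definition bmap_ip (X Y : finspace C) (E F : bundle X Y) (f g : bmap E F) : C :=
  \sum_(x : X) \sum_(y : Y) wt x * wt y * htrace (adj (f y x) \o g y x)%VF.

Definition bmap_lin (X Y : finspace C) (E F : bundle X Y) (a : C) (f g : bmap E F) :
    bmap E F := fun y x => a *: f y x + g y x.

Definition bracket_ob (H : mark2hilb C) : finspace C :=
  FinSpace (@scale_factor_gt0 C H).

Definition bracket_mor (H K : mark2hilb C) (F : sfun H K) :
    bundle (bracket_ob H) (bracket_ob K) :=
  fun (m : midx K) (i : midx H) => hom (mobj m) (F (mobj i)).

Definition bracket_cell (H K : mark2hilb C) (F G : sfun H K) (t : ntrans F G) :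
    bmap (bracket_mor F) (bracket_mor G) :=
  fun (m : midx K) (i : midx H) =>
    linfun (fun f : hom (mobj m) (F (mobj i)) => hcomp (t (mobj i)) f).

Definition bracket_compositor (H K L : mark2hilb C) (G : sfun K L) (F : sfun H K) :
    bmap (bcomp (bracket_mor G) (bracket_mor F)) (bracket_mor (sfun_comp G F)) :=
  fun (l : midx L) (i : midx H) =>
    blift (F := bracket_mor G) (E := bracket_mor F)
      (U := bracket_mor (sfun_comp G F) l i)
      (fun m (g : hom (mobj l) (G (mobj m))) (f : hom (mobj m) (F (mobj i))) =>
         hcomp (sf1 G f) g).

(* The identity of mobj i if j = i, and 0 otherwise. *)
Definition diag_hid (H : mark2hilb C) (j i : midx H) : hom (mobj j) (mobj i) :=
  if i =P j is ReflectT e then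
    ecast z (hom (mobj z) (mobj i)) e (hid (mobj i))
  else 0.

Definition bracket_unit (H : mark2hilb C) :
    bmap (bid (bracket_ob H)) (bracket_mor (sfun_id H)) :=
  fun (j i : midx H) =>
    linfun (fun u : bid (bracket_ob H) j i => bid_sc u *: diag_hid j i).

Arguments bracket_unit : clear implicits.

Definition bracket : psfun (TwoHilbM C) (FinSpaces C) :=
  @PsFun (TwoHilbM C) (FinSpaces C) bracket_ob bracket_mor bracket_cell
    bracket_compositor bracket_unit.

Lemma bracket_cellE (H K : mark2hilb C) (F G : sfun H K) (t : ntrans F G) m i
    (f : bracket_mor F m i) : bracket_cell t m i f = hcomp (t (mobj i)) f.
Proof.
have l : linear (fun f : hom (mobj m) (F (mobj i)) => hcomp (t (mobj i)) f).
  exact: (hcomp_bilin _ _ _).2.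
pose g : {linear hom (mobj m) (F (mobj i)) -> hom (mobj m) (G (mobj i))} :=
  HB.pack (fun f : hom (mobj m) (F (mobj i)) => hcomp (t (mobj i)) f)
    (GRing.isLinear.Build _ _ _ _ _ l).
exact: (lfunE g).
Qed.

Lemma bracket_compositorE (H K L : mark2hilb C) (G : sfun K L) (F : sfun H K) l m i
    (g : bracket_mor G l m) (f : bracket_mor F m i) :
  bracket_compositor G F l i (bpure g f) = hcomp (sf1 G f) g.
Proof.
apply: blift_pure => m'; split=> [w a s t|v a s t]; first exact: (hcomp_bilin _ _ _).2.
by rewrite (sf1_linear G) (hcomp_bilin _ _ _).1.
Qed.

Lemma bracket_unitE (H : mark2hilb C) (i : bracket_ob H) :
  bracket_unit H i i (bid1 i) = hid (mobj i).
Proof.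
have l : linear (fun u : bid (bracket_ob H) i i => bid_sc u *: diag_hid i i).
  by move=> a u v; rewrite bid_sc_scalar scalerDl scalerA.
pose g : {linear bid (bracket_ob H) i i -> hom (mobj i) (mobj i)} :=
  HB.pack (fun u : bid (bracket_ob H) i i => bid_sc u *: diag_hid i i)
    (GRing.isLinear.Build _ _ _ _ _ l).
have -> : bracket_unit H i i (bid1 i) = bid_sc (bid1 i) *: diag_hid i i by exact: (lfunE g).
rewrite bid_sc1 scale1r /diag_hid; case: eqP => // e.
by rewrite (eq_axiomK e).
Qed.

Definition unitary_coherence : Prop :=
  (forall (H K L : mark2hilb C) (G : sfun K L) (F : sfun H K),
     bmap_unitary (bracket_compositor G F)) /\
  (forall H : mark2hilb C, bmap_unitary (bracket_unit H)).

Definition unitary_on_2morphisms : Prop :=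
  forall (H K : mark2hilb C) (F G : sfun H K),
    [/\ forall a (s t : ntrans F G), bracket_cell (nt_lin a s t) =
           bmap_lin a (bracket_cell s) (bracket_cell t),
        forall s t : ntrans F G,
          bmap_ip (bracket_cell s) (bracket_cell t) = nt_ip s t
      & bijective (@bracket_cell H K F G)].

End Bracket.
Arguments bracket_unit {C} H.

(* Main.v *)
From HB Require Import structures.
From mathcomp Require Import all_boot all_order all_algebra.
From mathcomp Require Import boolp reals complex.
Require Import Defs.

(** Everything rests on one identity in a marked 2-Hilbert space.  By Schur's
lemma, [f^* g] is the scalar [(f, g) / k_i] times the identity of [e_i], for [f]
and [g] in [Hom(e_i, x)].  Therefore, if [f_a] runs through an orthonormal basis
of [Hom(e_i, x)], the endomorphism [\sum_i \sum_a k_i f_a f_a^*] of [x] fixes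
every morphism out of a marked simple object; as every nonzero object receives a
nonzero morphism from a simple one, this endomorphism is the identity
([completeness]).

The same scalar [(f, g) / k_i] makes [g (x) f |-> F(f) g] an isometry for the
weight [1 / k_i] of the convolution product, and [completeness] makes it
surjective ([comp_map_unitary]); the compositor is a special case.
The coherence laws of the bracket are then equalities of linear maps, checked on
pure tensors.  On 2-morphisms, [completeness] turns the weighted trace into
[(id, s^* t)] at each marked simple object ([bracket_cell_ip]), and it extends
any family of components at the marked simple objects to a natural
transformation ([bracket_cell_surj]).

For the equivalence, a weak inverse sends a weighted set [X] to the category of
bundles on [X], that is, of morphisms from a one-point space to [X], on which
bundles [X -> Y] act by composition ([bundle_functor]).  Its coherence is that of
the target.  Its simple objects are the lines over the points of [X], and their
scale factors are the weights of the points ([bundle_scale_factor]).  Going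
around one way, [x] is compared with its fibres [Hom(e_i, x)]: this functor is
fully faithful by [completeness] and surjective up to unitary isomorphism by
counting dimensions, and its coherence with *-functors is again [comp_map].
Going around the other way, an element of a fibre is compared with the section
that it spans over a line ([coev]). *)

Set Implicit Arguments.
Unset Strict Implicit.
Unset Printing Implicit Defensive.
Import Order.TTheory GRing.Theory Num.Theory.
Local Open Scope ring_scope.
Local Notation "f \oc g" := (hcomp f g) (at level 40, left associativity).

(** * Finite-dimensional Hilbert spaces *)

Section LinearAlgebra.
Variable C : numClosedFieldType.

(** The linear map of a function whose linearity is only known as a proposition. *)
Definition mkhom (V W : vectType C) (f : V -> W) (lf : linear f) : 'Hom(V, W) :=
  let g : {linear V -> W} := HB.pack f (GRing.isLinear.Build _ _ _ _ _ lf) in linfun g.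

Lemma mkhomE (V W : vectType C) (f : V -> W) (lf : linear f) v : mkhom lf v = f v.
Proof. exact: lfunE. Qed.

Lemma linfun_linE (V W : vectType C) (f : V -> W) : linear f -> linfun f =1 f.
Proof. by move=> lf v; exact: (mkhomE lf v). Qed.

Lemma dim_lt_inj (V W : vectType C) (f : 'Hom(V, W)) w :
  (forall v, f v = 0 -> v = 0) -> (forall v, f v != w) -> (dim V < dim W)%N.
Proof.
move=> inj nw; have k0 : lker f == 0%VS.
  rewrite -subv0; apply/subvP => v; rewrite memv_ker memv0 => /eqP /inj ->.
  exact: eqxx.
have := limg_dim_eq (U := fullv) (f := f); rewrite (eqP k0) capv0 => /(_ erefl) e.
rewrite ltnNge; apply/negP => le.
have : limg f == fullv by rewrite eqEdim subvf /= dimvf e dimvf.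
move/eqP => e'; have : w \in limg f by rewrite e' memvf.
by case/memv_imgP => v _ ew; case/eqP: (nw v).
Qed.

Lemma ip_eq0 (V : hilb C) (v : V) : ip v v = 0 -> v = 0.
Proof.
by move=> e; apply/eqP; apply: contraT => /ip_gt0; rewrite e ltxx.
Qed.

Lemma ip_injl (V : hilb C) (u v : V) : (forall w, ip u w = ip v w) -> u = v.
Proof. by move=> e; apply: ip_inj => w; rewrite ip_conj e -ip_conj. Qed.

Lemma adjPr (V W : hilb C) (f : 'Hom(V, W)) v w : ip w (f v) = ip (adj f w) v.
Proof. by rewrite ip_conj adjP -ip_conj. Qed.

Lemma adj_uniq (V W : hilb C) (f : 'Hom(V, W)) (g : 'Hom(W, V)) :
  (forall v w, ip (f v) w = ip v (g w)) -> adj f = g.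
Proof. by move=> h; apply/lfunP => w; apply: ip_inj => v; rewrite -adjP h. Qed.

Lemma adjK (V W : hilb C) (f : 'Hom(V, W)) : adj (adj f) = f.
Proof. by apply: adj_uniq => v w; rewrite -adjPr. Qed.

Lemma adj_comp (U V W : hilb C) (f : 'Hom(V, W)) (g : 'Hom(U, V)) :
  adj (f \o g)%VF = (adj g \o adj f)%VF.
Proof. by apply: adj_uniq => v w; rewrite !comp_lfunE !adjP. Qed.

Lemma adj_antilin (V W : hilb C) a (f g : 'Hom(V, W)) :
  adj (a *: f + g) = a^* *: adj f + adj g.
Proof.
apply: adj_uniq => v w.
by rewrite !(add_lfunE, scale_lfunE) ipDl ipDr ipZl ipZr !adjP.
Qed.

Lemma isometry_adj (V W : hilb C) (f : 'Hom(V, W)) :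
  (forall u v, ip (f u) (f v) = ip u v) -> (adj f \o f)%VF = \1%VF.
Proof.
move=> h; apply/lfunP => v; rewrite comp_lfunE id_lfunE.
by apply: ip_inj => u; rewrite -adjP h.
Qed.

(** A surjective isometry is unitary: the adjoint, a left inverse of the
isometry, is then a right inverse too. *)
Lemma isometry_surj_adj (V W : hilb C) (f : 'Hom(V, W)) :
  (forall u v, ip (f u) (f v) = ip u v) -> (forall w, exists v, w = f v) ->
  (f \o adj f)%VF = \1%VF.
Proof.
move=> h s; apply/lfunP => w; rewrite comp_lfunE id_lfunE.
by have [v ->] := s w; rewrite -[adj f _]comp_lfunE isometry_adj // id_lfunE.
Qed.

Section Sub.
Variables (V : hilb C) (U : {vspace V}).
Let sip (u v : subvs_of U) := ip (vsval u) (vsval v).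
Fact sub_ip_scalar u : scalar (sip u).
Proof. by move=> a v w; rewrite /sip (linearP vsval) ipDr ipZr. Qed.
Fact sub_ip_conj u v : sip v u = (sip u v)^*. Proof. exact: ip_conj. Qed.
Fact sub_ip_gt0 u : u != 0 -> 0 < sip u u.
Proof.
move=> u0; apply: ip_gt0; apply: contraNneq u0 => e.
by apply/eqP; apply: subvs_inj; rewrite e linear0.
Qed.
Definition sub_hilb : hilb C := Hilb sub_ip_scalar sub_ip_conj sub_ip_gt0.

(** The adjoint of the inclusion of a subspace is the orthogonal projection. *)
Lemma orth_proj v : exists2 e, e \in U & forall a, a \in U -> ip a e = ip a v.
Proof.
pose i : 'Hom(sub_hilb, V) := linfun (vsval (U := U)).
exists (vsval (adj i v)) => [|a aU]; first exact: subvsP.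
have ea : a = i (vsproj U a) by rewrite lfunE /= vsprojK.
by rewrite [in RHS]ea adjP [in LHS]ea lfunE.
Qed.
End Sub.

Lemma eigenvector_exists (V : hilb C) (f : 'End(V)) (v0 : V) : v0 != 0 ->
  exists a v, v != 0 /\ f v = a *: v.
Proof.
(* The rows of [M] are the images of the basis vectors, so that a left
   eigenvector of [M] lists the coordinates of an eigenvector of [f]. *)
move=> v0n; pose M := \matrix_(i, j) ip (hbase j) (f (hbase (V := V) i)).
have n0 : hdim V != 0.
  apply: contraNneq v0n => e; rewrite (hbase_exp v0) big1 // => i.
  by move: (ltn_ord i); rewrite [X in (_ < X)%N](e : hdim V = 0).
have : size (char_poly M) != 1 by rewrite size_char_poly eqSS.
case/closed_rootP => a; rewrite -eigenvalue_root_char => /eigenvalueP[r er r0].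
exists a, (\sum_i r 0 i *: hbase i); split.
  apply: contraNneq r0 => e; apply/eqP/rowP => i; rewrite mxE.
  have := congr1 (ip (hbase i)) e; rewrite ip0r ip_sumr (bigD1 i) //= ipZr hbase_on.
  rewrite eqxx mulr1 big1 ?addr0 // => j ne.
  by rewrite ipZr hbase_on eq_sym (negPf ne) mulr0.
rewrite linear_sum scaler_sumr.
rewrite (eq_bigr (fun i => \sum_j (r 0 i * M i j) *: hbase j)); last first.
  move=> i _; rewrite linearZ /= [f _]hbase_exp scaler_sumr.
  by apply: eq_bigr => j _; rewrite mxE scalerA.
rewrite exchange_big; apply: eq_bigr => j _ /=.
rewrite -scaler_suml scalerA; congr (_ *: _).
by have /rowP/(_ j) := er; rewrite !mxE.
Qed.

End LinearAlgebra.

(** * Schur's lemma and complete reducibility *)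

Section HStarTheory.
Variables (C : numClosedFieldType) (H : hstar C).
Implicit Types x y z : H.

HB.instance Definition _ x y z (f : hom y z) :=
  GRing.isLinear.Build C (hom x y) (hom x z) _ (@hcomp C H x y z f)
    ((hcomp_bilin x y z).2 f).

Definition precomp x y z (g : hom x y) (f : hom y z) : hom x z := f \oc g.
Fact precomp_linear x y z (g : hom x y) : linear (@precomp x y z g).
Proof. exact: (hcomp_bilin x y z).1. Qed.
HB.instance Definition _ x y z (g : hom x y) :=
  GRing.isLinear.Build C (hom y z) (hom x z) _ (@precomp x y z g)
    (precomp_linear g).

Section Bilinear.
Variables (x y z : H) (f f' : hom y z) (g g' : hom x y).
Lemma comp0l : (0 : hom y z) \oc g = 0. Proof. exact: (raddf0 (precomp g)). Qed.
Lemma comp0r : f \oc (0 : hom x y) = 0. Proof. exact: raddf0. Qed.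
Lemma compBl : (f - f') \oc g = f \oc g - f' \oc g.
Proof. exact: (raddfB (precomp g)). Qed.
Lemma compBr : f \oc (g - g') = f \oc g - f \oc g'. Proof. exact: raddfB. Qed.
Lemma compZl a : (a *: f) \oc g = a *: (f \oc g).
Proof. exact: (linearZ_LR (precomp g)). Qed.
Lemma compZr a : f \oc (a *: g) = a *: (f \oc g).
Proof. exact: (linearZ_LR (hcomp f)). Qed.
Lemma comp_suml I r (P : pred I) (F : I -> hom y z) :
  (\sum_(i <- r | P i) F i) \oc g = \sum_(i <- r | P i) (F i \oc g).
Proof. exact: (raddf_sum (precomp g)). Qed.
Lemma comp_sumr I r (P : pred I) (F : I -> hom x y) :
  f \oc (\sum_(i <- r | P i) F i) = \sum_(i <- r | P i) (f \oc F i).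
Proof. exact: raddf_sum. Qed.
End Bilinear.

Lemma dagD x y (f g : hom x y) : hdag (f + g) = hdag f + hdag g.
Proof. by have := hdag_antilin 1 f g; rewrite rmorph1 !scale1r. Qed.
Lemma dag0 x y : hdag (0 : hom x y) = 0.
Proof. by apply: (addrI (hdag (0 : hom x y))); rewrite -dagD !addr0. Qed.

Lemma ip_dag x y z (f : hom y z) (g : hom x z) (h : hom x y) :
  ip g (f \oc h) = ip (hdag f \oc g) h.
Proof. by rewrite ip_conj ip_hcompl -ip_conj. Qed.

Lemma dag_eq0 x y (f : hom x y) : hdag f = 0 -> f = 0.
Proof. by move=> e; rewrite -[f]hdagK e dag0. Qed.

Lemma mono_eq0 x y (m : hom x y) z (f : hom z x) : is_mono m -> m \oc f = 0 -> f = 0.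
Proof. by move=> mm e; apply: mm; rewrite e comp0r. Qed.

(** The morphisms killed by [h] form a right ideal of [End x]; the orthogonal
projection of the identity onto it is a projection onto the kernel of [h].
As the ideal [I] is stable under right multiplication, that [(a, e) = (a, 1)] for
all [a] in [I] amounts to [e^* a = a] for all [a] in [I], and [a := e] shows that [e] is a self-adjoint idempotent. *)
Lemma kernel_projection x y (h : hom x y) : exists e : hom x x,
  [/\ hdag e = e, e \oc e = e, h \oc e = 0 &
      forall z (g : hom z x), h \oc g = 0 -> e \oc g = g].
Proof.
pose U := lker (linfun (@hcomp C H x x y h)).
have inU a : (a \in U) = (h \oc a == 0) by rewrite memv_ker lfunE.
have [e eU pe] := orth_proj U (hid x).
have he : h \oc e = 0 by apply/eqP; rewrite -inU.
have ea z (a : hom z x) : h \oc a = 0 -> hdag e \oc a = a.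
  (* [a b^*] is again killed by [h], for every [b : z -> x]. *)
  move=> ha; apply: ip_injl => b; have := pe (a \oc hdag b).
  rewrite inU hcompA ha comp0l eqxx [ip (hdag e \oc a) _]ip_hcompl.
  by rewrite !ip_hcompr !hdagK hcomp1l; apply.
have ee : hdag e = e by rewrite -{1}(ea _ e he) hdagM hdagK ea.
exists e; split=> // [|z g hg]; first by rewrite -{1}ee ea.
by rewrite -{1}ee ea.
Qed.
End HStarTheory.

Section Schur.
Variables (C : numClosedFieldType) (H : hstar C).
Hypothesis spl : idempotents_split H.
Implicit Types x y z : H.

(** The kernel projection of [h] splits, and its image is a subobject of [x]:
either zero, so that [h] is mono, or all of [x], so that [h] vanishes. *)
Lemma simple_mono x y (h : hom x y) : is_simple x -> h != 0 -> is_mono h.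
Proof.
move=> [_ sx] h0; have [e [_ ee he eK]] := kernel_projection h.
have [z [r [s [rs sr]]]] := spl ee.
have ms : is_mono s.
  by move=> w f g /(congr1 (hcomp r)); rewrite !hcompA rs !hcomp1l.
have [s0|[t [ts st]]] := sx _ s ms.
  move=> w f g /eqP; rewrite -subr_eq0 -compBr => /eqP /eK.
  by rewrite -sr s0 !comp0l => /esym/eqP; rewrite subr_eq0 => /eqP.
case/eqP: h0; have : h \oc (s \oc r) = 0 by rewrite sr.
move/(congr1 (fun f => f \oc (s \oc t))).
by rewrite comp0l -!hcompA (hcompA r s t) rs hcomp1l st hcomp1r.
Qed.

Lemma schur_zero x y (h : hom x y) :
  is_simple x -> is_simple y -> ~ isomorphic x y -> h = 0.
Proof.
move=> sx sy nxy; apply/eqP; apply: contraT => h0.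
have [e|i] := sy.2 _ h (simple_mono sx h0); first by rewrite e eqxx in h0.
by case: nxy; exists h.
Qed.

(** Composition with [f] has an eigenvalue [a] on [End x]; as [f - a] is then not
mono, it vanishes. *)
Lemma schur_scalar x (f : hom x x) : is_simple x -> exists a, f = a *: hid x.
Proof.
move=> sx; have [a [g [g0]]] := eigenvector_exists (linfun (hcomp f)) sx.1.
rewrite lfunE /= => e; exists a; apply/eqP; rewrite -subr_eq0; apply: contraNT g0 => n0.
apply/eqP; apply: (mono_eq0 (simple_mono sx n0)).
by rewrite compBl compZl hcomp1l e subrr.
Qed.

(** If [m : z -> y] is mono but not invertible, [f |-> m f m^*] embeds [End z]
into [End y] and misses the identity; hence passing to proper subobjects lowers
the dimension of the endomorphism algebra and must end in a simple object. *)
Lemma exists_simple_map y : hid y != 0 ->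
  exists x, is_simple x /\ exists f : hom x y, f != 0.
Proof.
have [n] := ubnP (dim (hom y y)); elim: n y => // n IH y le y0.
have [sy|/existsNP[z /existsNP[m]]] :=
  pselect (forall z (m : hom z y), is_mono m -> m = 0 \/ is_iso m).
  by exists y; split=> //; exists (hid y).
move=> /not_implyP[mm /not_orP[/eqP m0 ni]].
have z0 : hid z != 0.
  by apply: contraNneq m0 => e; rewrite -[m]hcomp1r e comp0r.
have lt : (dim (hom z z) < dim (hom y y))%N.
  have lf : linear (fun f : hom z z => m \oc f \oc hdag m).
    by move=> a f g; rewrite linearP hcompDl.
  apply: (dim_lt_inj (f := mkhom lf) (w := hid y)) => [f|f]; rewrite mkhomE.
    move=> e; apply: (mono_eq0 mm); apply: dag_eq0; apply: (mono_eq0 mm).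
    by have := congr1 (@hdag _ _ _ _) e; rewrite hdagM hdagK dag0.
  apply/eqP => e; apply: ni; exists (f \oc hdag m); split; last by rewrite hcompA.
  by apply: mm; rewrite !hcompA e hcomp1l hcomp1r.
have [x [sx [f f0]]] := IH z (leq_trans lt le) z0.
exists x; split=> //; exists (m \oc f).
by apply: contraNneq f0 => /(mono_eq0 mm) ->.
Qed.
End Schur.

Section Marked.
Variables (C : numClosedFieldType) (H : mark2hilb C).
Implicit Types (x y : H) (i j : midx H).
Local Notation k := (@scale_factor C H).
Let spl : idempotents_split H := (mcauchy H).2.

Lemma scale_factor_neq0 i : k i != 0.
Proof. exact: lt0r_neq0 (scale_factor_gt0 i). Qed.

Lemma hom_diff_mark i j (h : hom (mobj i) (mobj j)) : i != j -> h = 0.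
Proof.
move/eqP=> ne; apply: (schur_zero spl _ (mobj_simple i) (mobj_simple j)).
by move/mobj_inj.
Qed.

Lemma hom_same_mark i (h : hom (mobj i) (mobj i)) :
  h = (ip (hid (mobj i)) h / k i) *: hid (mobj i).
Proof.
have [a ->] := schur_scalar spl h (mobj_simple i).
by rewrite ipZr mulfK ?scale_factor_neq0.
Qed.

Lemma dag_comp_mark i x (f g : hom (mobj i) x) :
  hdag f \oc g = (ip f g / k i) *: hid (mobj i).
Proof. by rewrite [LHS]hom_same_mark ip_dag hdagK hcomp1r. Qed.

(** Against [u : e_j -> x], the basis vectors with [i != j] contribute zero, and
the scalars [(f_a, u) / k_j] produced by the others are the coordinates of [u]
up to the factor [k_j], which is cancelled by the weight. *)
Lemma sum_mark_comp x y (p : forall i, 'Hom(hom (mobj i) x, hom (mobj i) y))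
    j (u : hom (mobj j) x) :
  (\sum_i \sum_a k i *: (p i (hbase a) \oc hdag (hbase a))) \oc u = p j u.
Proof.
rewrite comp_suml (bigD1 j) //= [X in _ + X]big1 => [|i ne]; last first.
  rewrite comp_suml big1 // => a _.
  by rewrite compZl -hcompA (hom_diff_mark (_ \oc u)) 1?eq_sym // comp0r scaler0.
rewrite addr0 comp_suml [in RHS](hbase_exp u) linear_sum; apply: eq_bigr => a _.
rewrite compZl -hcompA dag_comp_mark compZr hcomp1r scalerA linearZ.
by rewrite mulrC divfK ?scale_factor_neq0.
Qed.

Definition mark_proj x : hom x x :=
  \sum_i \sum_a k i *: (hbase a \oc hdag (hbase a : hom (mobj i) x)).

Lemma mark_projK j x (g : hom (mobj j) x) : mark_proj x \oc g = g.
Proof.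
rewrite -[RHS](id_lfunE g) -(sum_mark_comp (fun i => \1%VF)); congr (_ \oc g).
by apply: eq_bigr => i _; apply: eq_bigr => a _; rewrite id_lfunE.
Qed.

(** The complement of [mark_proj x] is an idempotent killing every morphism out
of a marked simple object.  Were it nonzero, its image would receive a nonzero
morphism from a simple object. *)
Theorem completeness x : mark_proj x = hid x.
Proof.
pose q := hid x - mark_proj x.
have qg i (g : hom (mobj i) x) : q \oc g = 0.
  by rewrite compBl hcomp1l mark_projK subrr.
have qq : q \oc q = q.
  rewrite {2}/q compBr hcomp1r [q \oc mark_proj x](_ : _ = 0) ?subr0 //.
  rewrite comp_sumr big1 // => i _; rewrite comp_sumr big1 // => a _.
  by rewrite compZr hcompA qg comp0l scaler0.
apply/eqP; rewrite eq_sym -subr_eq0 -/q; apply: contraT => q0.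
have [y [r [s [rs sr]]]] := spl qq.
have y0 : hid y != 0.
  by apply: contraNneq q0 => e; rewrite -sr -[s]hcomp1r e comp0r comp0l.
have [z [sz [g g0]]] := exists_simple_map y0.
have [i [u [v [vu uv]]]] := mobj_cover sz.
case/eqP: g0; have := qg i (s \oc (g \oc u)).
move/(congr1 (fun f => r \oc f \oc v)).
rewrite comp0r comp0l -sr -!hcompA uv hcomp1r.
by rewrite (hcompA r s) rs hcomp1l hcompA rs hcomp1l.
Qed.

Lemma completeness_comp x y (f : hom x y) :
  f = \sum_i \sum_a k i *: (f \oc hbase a \oc hdag (hbase a : hom (mobj i) x)).
Proof.
rewrite -[LHS]hcomp1r -completeness comp_sumr; apply: eq_bigr => i _.
by rewrite comp_sumr; apply: eq_bigr => a _; rewrite compZr hcompA.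
Qed.

Lemma hom_ext x y (f g : hom x y) :
  (forall i (u : hom (mobj i) x), f \oc u = g \oc u) -> f = g.
Proof.
move=> e; rewrite (completeness_comp f) (completeness_comp g).
by apply: eq_bigr => i _; apply: eq_bigr => a _; rewrite e.
Qed.

(** A family of linear maps between the hom-spaces out of the marked simple
objects has no compatibility condition to satisfy: by Schur's lemma, naturality
among the marked simple objects is linearity. *)
Lemma exists_hom_of_maps x y (p : forall i, 'Hom(hom (mobj i) x, hom (mobj i) y)) :
  exists f : hom x y, forall i (u : hom (mobj i) x), f \oc u = p i u.
Proof.
by exists (\sum_i \sum_a k i *: (p i (hbase a) \oc hdag (hbase a))); exact: sum_mark_comp.
Qed.
End Marked.

(** * Composition of hom-spaces through the marked simple objects *)

Section Convolution.
Variable C : numClosedFieldType.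

Section Pure.
Variables (X Y Z : finspace C) (F : bundle Y Z) (E : bundle X Y) (z : Z) (x : X).

Lemma bcomp_ind (P : bcomp F E z x -> Prop) :
  P 0 -> (forall a s t, P s -> P t -> P (a *: s + t)) ->
  (forall y (v : F z y) (w : E y x), P (bpure v w)) -> forall s, P s.
Proof.
move=> P0 Pl Pp.
have Ps I (r : seq I) (A : I -> bcomp F E z x) :
    (forall i, P (A i)) -> P (\sum_(i <- r) A i).
  by move=> h; elim/big_rec: _ => // i s _; rewrite -[A i]scale1r; exact: Pl.
move=> s; rewrite (cinj_exp s); apply: (Ps) => y.
rewrite (tens_exp (s y)) linear_sum; apply: (Ps) => i.
rewrite linear_sum; apply: Ps => j.
by rewrite linearZ -[X in P X]addr0; apply: Pl => //; exact: Pp.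
Qed.

Lemma ip_bpure y (v v' : F z y) (w w' : E y x) :
  ip (bpure v w : bcomp F E z x) (bpure v' w') = (wt y)^-1 * (ip v v' * ip w w').
Proof. exact: ip_cpure. Qed.

Lemma ip_bpure_off y y' (v : F z y) (w : E y x) (v' : F z y') (w' : E y' x) :
  y != y' -> ip (bpure v w : bcomp F E z x) (bpure v' w') = 0.
Proof.
move=> ne; rewrite /= /dsum_ip big1 // => u _; rewrite !mksectE.
have [e|ne'] := eqVneq y u.
  rewrite [X in ip _ X]dfwith_out ?ip0r ?mulr0 //.
  by rewrite -e eq_sym.
by rewrite [X in ip X _]dfwith_out ?ip0l ?mulr0.
Qed.

Lemma isometry_bpure (U : hilb C) (f : 'Hom(bcomp F E z x, U)) :
  (forall y y' (v : F z y) (w : E y x) (v' : F z y') (w' : E y' x),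
    ip (f (bpure v w)) (f (bpure v' w')) = ip (bpure v w : bcomp F E z x) (bpure v' w')) ->
  forall s t, ip (f s) (f t) = ip s t.
Proof.
move=> h; apply: bcomp_ind => [t|a s s' hs hs' t|y v w].
- by rewrite linear0 !ip0l.
- by rewrite linearP !ipDl !ipZl hs hs'.
apply: bcomp_ind => [|a s s' hs hs'|y' v' w'] //.
- by rewrite linear0 !ip0r.
- by rewrite linearP !ipDr !ipZr hs hs'.
Qed.
End Pure.

HB.instance Definition _ (H K : hstar C) (F : sfun H K) x y :=
  GRing.isLinear.Build C (hom x y) (hom (F x) (F y)) _ (@sf1 C H K F x y)
    (@sf1_linear C H K F x y).

Lemma sf1Z (H K : hstar C) (F : sfun H K) x y a (f : hom x y) :
  sf1 F (a *: f) = a *: sf1 F f.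
Proof. exact: (linearZ_LR (@sf1 C H K F x y)). Qed.

Definition point : finspace C := @FinSpace C unit (fun=> 1) (fun=> ltr01).

Definition hom_bundle (H : mark2hilb C) (x : H) : bundle point (bracket_ob H) :=
  fun i _ => hom (mobj i) x.

Section CompMap.
Variables (H K : mark2hilb C) (F : sfun H K).
Local Notation k := (@scale_factor C H).

(** The compositor is the case of a marked simple object [x].  The general case
compares [x] with its fibres [Hom(e_i, x)] compatibly with [F]. *)
Definition comp_map (x : H) :
    bmap (bcomp (bracket_mor F) (hom_bundle x)) (hom_bundle (F x)) :=
  fun l t => blift (F := bracket_mor F) (E := hom_bundle x) (U := hom_bundle (F x) l t)
    (fun i (g : hom (mobj l) (F (mobj i))) (f : hom (mobj i) x) => sf1 F f \oc g).

Lemma comp_mapE x l t i (g : bracket_mor F l i) (f : hom_bundle x i t) :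
  comp_map x l t (bpure g f) = sf1 F f \oc g.
Proof.
apply: blift_pure => m'; split=> [w a u v|v a u w]; first exact: linearP.
by rewrite linearP hcompDl.
Qed.

(** Since [f^* f'] is a multiple of an identity, of ratio [(f, f') / k_i],
composing loses exactly the weight of the convolution product. *)
Lemma comp_map_isometry x l t u v : ip (comp_map x l t u) (comp_map x l t v) = ip u v.
Proof.
apply: isometry_bpure u v => i j g f g' f'; rewrite !comp_mapE.
rewrite ip_hcompl -sf1_dag hcompA -sf1_comp.
have [e|ne] := eqVneq i j.
  case: _ / e in g' f' *; rewrite dag_comp_mark sf1Z sf1_id compZl hcomp1l.
  by rewrite ipZr ip_bpure [LHS]mulrC mulrA mulrC.
by rewrite (hom_diff_mark (hdag f \oc f')) 1?eq_sym // linear0 comp0l ip0r ip_bpure_off.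
Qed.

Lemma sf1_completeness x : hid (F x) =
  \sum_i \sum_a k i *: (sf1 F (hbase a) \oc hdag (sf1 F (hbase a : hom (mobj i) x))).
Proof.
rewrite -(sf1_id F) -completeness linear_sum; apply: eq_bigr => i _.
rewrite linear_sum; apply: eq_bigr => a _.
by rewrite linearZ /= sf1_comp sf1_dag.
Qed.

(** The resolution of the identity of [F x] writes [h] as the sum of the
[k_i F(f_a) (F(f_a)^* h)]. *)
Lemma comp_map_surj x l t h : exists u, h = comp_map x l t u.
Proof.
exists (\sum_i \sum_a k i *:
  bpure (hdag (sf1 F (hbase a)) \oc h : bracket_mor F l i) (hbase a : hom_bundle x i t)).
rewrite -[LHS]hcomp1l sf1_completeness comp_suml linear_sum; apply: eq_bigr => i _.
rewrite comp_suml linear_sum; apply: eq_bigr => a _.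
by rewrite compZl linearZ /= comp_mapE hcompA.
Qed.

Lemma comp_map_unitary x : bmap_unitary (comp_map x).
Proof.
split; apply: bmapP => l t; first exact: isometry_adj (@comp_map_isometry x l t).
exact: isometry_surj_adj (@comp_map_isometry x l t) (@comp_map_surj x l t).
Qed.

Lemma hom_ext_image x z (f g : hom (F x) z) :
  (forall i (u : hom (mobj i) x), f \oc sf1 F u = g \oc sf1 F u) -> f = g.
Proof.
move=> e; rewrite -[f]hcomp1r -[g]hcomp1r sf1_completeness !comp_sumr.
apply: eq_bigr => i _; rewrite !comp_sumr; apply: eq_bigr => a _.
by rewrite !compZr !hcompA e.
Qed.
End CompMap.

Lemma bracket_compositor_unitary (H K L : mark2hilb C) (G : sfun K L) (F : sfun H K) :
  bmap_unitary (bracket_compositor G F).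
Proof.
have u i := comp_map_unitary G (F (mobj i)).
split; apply: bmapP => l i.
  exact: (congr1 (fun h => h l tt) (u i).1).
exact: (congr1 (fun h => h l tt) (u i).2).
Qed.

Lemma bracket_unit_scE (H : mark2hilb C) (i : bracket_ob H) (u : bid (bracket_ob H) i i) :
  bracket_unit H i i u = bid_sc u *: hid (mobj i).
Proof. by rewrite {1}[u]bidE linearZ /= bracket_unitE. Qed.

(** The norm of [1] over the point [i] is [k_i], which is that of the identity of
[e_i]; Schur's lemma gives surjectivity. *)
Lemma bracket_unit_unitary (H : mark2hilb C) : bmap_unitary (bracket_unit H).
Proof.
have iso j i u v : ip (bracket_unit H j i u) (bracket_unit H j i v) = ip u v.
  have [e|ne] := eqVneq j i; last by rewrite (bid0 u ne) !(linear0, ip0l).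
  case: _ / e in u v *; rewrite !bracket_unit_scE [u in RHS]bidE [v in RHS]bidE.
  rewrite !(ipZl, ipZr); congr (_ * (_ * _)).
  rewrite /= /scale_ip /= /mx_ip (eq_bigr (fun=> 1)) => [|a _].
    by rewrite sumr_const card_ord mulr1.
  rewrite (eq_bigr (fun=> 1)) => [|b _]; last by rewrite !mxE conjC1 mulr1.
  by rewrite sumr_const card_ord eqxx.
have su j i w : exists u, w = bracket_unit H j i u.
  have [e|ne] := eqVneq j i; last first.
    by exists 0; rewrite linear0; exact: (hom_diff_mark w).
  case: _ / e in w *; exists ((ip (hid (mobj j)) w / scale_factor j) *: bid1 (j : bracket_ob H)).
  by rewrite linearZ /= bracket_unitE; exact: hom_same_mark.
split; apply: bmapP => j i; first exact: isometry_adj (@iso _ _).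
exact: isometry_surj_adj (@iso _ _) (@su _ _).
Qed.

Lemma bracket_unitary_coherence : unitary_coherence C.
Proof. by split; [exact: bracket_compositor_unitary|exact: bracket_unit_unitary]. Qed.
End Convolution.

(** * The bracket as a weak 2-functor *)

Section BracketFunctor.
Variable C : numClosedFieldType.

Lemma bmap_vcE (X Y : finspace C) (E F G : bundle X Y) (g : bmap F G) (f : bmap E F) y x v :
  bmap_vc g f y x v = g y x (f y x v).
Proof. exact: comp_lfunE. Qed.
Lemma bmap_idE (X Y : finspace C) (E : bundle X Y) y x v : bmap_id E y x v = v.
Proof. exact: id_lfunE. Qed.

Lemma unitary_inv2 (X Y : FinSpaces C) (E F : mor X Y) (f : cell E F) :
  bmap_unitary f -> inv2 f.
Proof. by move=> [h h']; exists (bmap_adj f). Qed.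

Theorem bracket_weak2functor : is_weak2functor (bracket C).
Proof.
split=> /=.
- move=> H K F; apply: bmapP => m i; apply/lfunP => f.
  by rewrite bracket_cellE bmap_idE hcomp1l.
- move=> H K F G L t s; apply: bmapP => m i; apply/lfunP => f.
  by rewrite bmap_vcE !bracket_cellE hcompA.
- by move=> H K L G F; apply: unitary_inv2; exact: bracket_compositor_unitary.
- by move=> H; apply: unitary_inv2; exact: bracket_unit_unitary.
- move=> H K L G G' F F' t s; apply: bmapP => l i; apply: bext => m g f.
  rewrite !bmap_vcE bmap_hcE !(bracket_compositorE, bracket_cellE) /=.
  by rewrite hcompA -nt_nat sf1_comp !hcompA.
- move=> H K L M E G F; apply: bmapP => l i; apply: bextL => k m h g f.
  rewrite !bmap_vcE !bmap_hcE bassoE !bmap_idE !bracket_compositorE.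
  rewrite bmap_hcE bmap_idE !bracket_compositorE bracket_cellE hcomp1l.
  by rewrite sf1_comp hcompA.
- move=> H K F; apply: bmapP => m i; apply: bext => m' u f.
  have [e|ne] := eqVneq m m'; last by rewrite bid_hom0 ?linear0.
  case: _ / e in u f *.
  rewrite !bmap_vcE bmap_hcE bmap_idE bracket_unit_scE bracket_compositorE.
  by rewrite bracket_cellE hcomp1l bluE compZr hcomp1r.
- move=> H K F; apply: bmapP => m i; apply: bext => i' f u.
  have [e|ne] := eqVneq i' i; last by rewrite bid_hom0r ?linear0.
  case: _ / e in u f *.
  rewrite !bmap_vcE bmap_hcE bmap_idE bracket_unit_scE bracket_compositorE.
  by rewrite bracket_cellE hcomp1l bruE sf1Z sf1_id compZl hcomp1l.
Qed.

(** * The bracket on 2-morphisms *)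

Section Cells.
Variables (H K : mark2hilb C) (F G : sfun H K).

Lemma bracket_cell_inj : injective (@bracket_cell C H K F G).
Proof.
move=> s t e; apply: ntransP => x; apply: hom_ext_image => i u.
rewrite !nt_nat; congr (_ \oc _); apply: hom_ext => m f.
have := congr1 (fun h : bmap (bracket_mor F) (bracket_mor G) => h m i f) e.
by rewrite !bracket_cellE.
Qed.

(** A natural transformation is freely determined by its components at the
marked simple objects: these extend to all objects along the resolution of the
identity, and naturality only has to be tested on morphisms out of simples. *)
Lemma bracket_cell_surj (p : bmap (bracket_mor F) (bracket_mor G)) :
  exists t : ntrans F G, bracket_cell t = p.
Proof.
have c i : exists f : hom (F (mobj i)) (G (mobj i)),
    forall m (u : hom (mobj m) (F (mobj i))), f \oc u = p m i u.
  exact: exists_hom_of_maps.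
pose q i := sval (cid (c i)).
have qE i m u : q i \oc u = p m i u by exact: (svalP (cid (c i)) m u).
pose t x : hom (F x) (G x) := \sum_i \sum_a scale_factor i *:
  (sf1 G (hbase a : hom (mobj i) x) \oc q i \oc hdag (sf1 F (hbase a))).
have tE x i (u : hom (mobj i) x) : t x \oc sf1 F u = sf1 G u \oc q i.
  rewrite comp_suml (bigD1 i) //= [X in _ + X]big1 => [|j ne]; last first.
    rewrite comp_suml big1 // => a _.
    rewrite compZl -hcompA -sf1_dag -sf1_comp.
    by rewrite (hom_diff_mark (_ \oc u)) 1?eq_sym // linear0 comp0r scaler0.
  rewrite addr0 comp_suml [in RHS](hbase_exp u) linear_sum comp_suml.
  apply: eq_bigr => a _.
  rewrite compZl -hcompA -sf1_dag -sf1_comp dag_comp_mark sf1Z sf1_id.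
  rewrite compZr hcomp1r scalerA linearZ /= compZl.
  by rewrite mulrC divfK ?scale_factor_neq0.
have tn x y (f : hom x y) : t y \oc sf1 F f = sf1 G f \oc t x.
  apply: hom_ext_image => i u.
  by rewrite -!hcompA tE -sf1_comp tE sf1_comp hcompA.
exists (NTrans tn); apply: bmapP => m i; apply/lfunP => f.
by rewrite bracket_cellE /= -qE -[t _]hcomp1r -sf1_id tE sf1_id hcomp1l.
Qed.

Lemma bracket_cell_bij : bijective (@bracket_cell C H K F G).
Proof.
exists (fun p => sval (cid (bracket_cell_surj p))) => [t|p].
  by apply: bracket_cell_inj; exact: (svalP (cid (bracket_cell_surj _))).
exact: (svalP (cid (bracket_cell_surj _))).
Qed.

(** The trace over [Hom(e_m, F e_i)], weighted by [k_m] and summed over [m],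
resolves the identity of [F e_i]. *)
Lemma bracket_cell_ip (s t : ntrans F G) :
  bmap_ip (bracket_cell s) (bracket_cell t) = nt_ip s t.
Proof.
apply: eq_bigr => i _ /=.
rewrite -[in RHS](hcomp1r (s _)) ip_hcompl -[in RHS]completeness ip_suml mulr_sumr.
apply: eq_bigr => m _; rewrite -mulrA; congr (_ * _).
rewrite ip_suml mulr_sumr; apply: eq_bigr => a _; rewrite mxE.
rewrite comp_lfunE -adjP !bracket_cellE ipZl (CrealP _) ?gtr0_real ?scale_factor_gt0 //.
by rewrite [in RHS]ip_hcompr hdagK -hcompA -ip_hcompl.
Qed.
End Cells.

Theorem bracket_unitary_on_2morphisms : unitary_on_2morphisms C.
Proof.
move=> H K F G; split; [|exact: bracket_cell_ip|exact: bracket_cell_bij].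
move=> a s t; apply: bmapP => m i; apply/lfunP => f.
by rewrite /bmap_lin add_lfunE scale_lfunE !bracket_cellE hcompDl.
Qed.
End BracketFunctor.

(** * The 2-Hilbert space of bundles over a weighted finite set *)

Section HilbertSchmidt.
Variables (C : numClosedFieldType) (V W : hilb C).
Definition hs_ip (f g : 'Hom(V, W)) : C := htrace (adj f \o g)%VF.

Lemma hs_ipE f g : hs_ip f g = \sum_a ip (f (hbase a)) (g (hbase a)).
Proof. by apply: eq_bigr => a _; rewrite mxE comp_lfunE -adjP. Qed.

Lemma hom_hbase_eq0 (f : 'Hom(V, W)) : (forall a, f (hbase a) = 0) -> f = 0.
Proof.
move=> h; apply/lfunP => v; rewrite [v in LHS]hbase_exp linear_sum lfunE /=.
by apply: big1 => a _; rewrite linearZ /= h scaler0.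
Qed.

Fact hs_ip_scalar f : scalar (hs_ip f).
Proof.
move=> a g h; rewrite !hs_ipE mulr_sumr -big_split; apply: eq_bigr => i _ /=.
by rewrite add_lfunE scale_lfunE ipDr ipZr.
Qed.
Fact hs_ip_conj f g : hs_ip g f = (hs_ip f g)^*.
Proof. by rewrite !hs_ipE rmorph_sum; apply: eq_bigr => a _; exact: ip_conj. Qed.
Fact hs_ip_gt0 f : f != 0 -> 0 < hs_ip f f.
Proof.
move=> f0; have ge v : 0 <= ip (f v) (f v).
  by have [->|/ip_gt0/ltW//] := eqVneq (f v) 0; rewrite ip0r.
rewrite hs_ipE lt_def sumr_ge0 // andbT; apply: contraNneq f0 => /eqP.
rewrite psumr_eq0 // => /allP z; apply/eqP/hom_hbase_eq0 => a; apply: ip_eq0.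
by apply/eqP; apply: z; exact: mem_index_enum.
Qed.
Definition hs_hilb : hilb C := Hilb hs_ip_scalar hs_ip_conj hs_ip_gt0.
End HilbertSchmidt.

Section HilbertSchmidtTheory.
Variable C : numClosedFieldType.
Implicit Types U V W : hilb C.

(** Cyclicity of the trace: both sides expand over pairs of basis vectors. *)
Lemma hs_ip_adj V W (f g : 'Hom(V, W)) : hs_ip f g = hs_ip (adj g) (adj f).
Proof.
rewrite !hs_ipE; under eq_bigr do rewrite parseval.
rewrite exchange_big; apply: eq_bigr => b _; rewrite [RHS]parseval.
apply: eq_bigr => a _ /=.
by rewrite -!ip_conj -[in RHS]adjPr -[in RHS]adjP mulrC.
Qed.

Lemma hs_ip_compl U V W (f : 'Hom(V, W)) (g : 'Hom(U, V)) h :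
  hs_ip (f \o g)%VF h = hs_ip g (adj f \o h)%VF.
Proof. by rewrite !hs_ipE; apply: eq_bigr => a _; rewrite !comp_lfunE adjP. Qed.

Lemma hs_ip_compr U V W (f : 'Hom(V, W)) (g : 'Hom(U, V)) h :
  hs_ip (f \o g)%VF h = hs_ip f (h \o adj g)%VF.
Proof.
rewrite hs_ip_adj adj_comp -[adj g]adjK -hs_ip_compl hs_ip_adj adjK.
by rewrite adj_comp !adjK.
Qed.

Lemma hdimE V : hdim V = dim V.
Proof.
have fr : free (onb V).
  apply/(@freeP _ _ _ (in_tuple (onb V))) => c /= e i.
  have := congr1 (ip (hbase (i : 'I_(hdim V)))) e; rewrite ip0r ip_sumr (bigD1 i) //=.
  rewrite ipZr -/(hbase i) hbase_on eqxx mulr1 big1 ?addr0 // => j ne.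
  by rewrite ipZr -/(hbase j) hbase_on eq_sym (negPf ne) mulr0.
have /eqP <- : \dim <<onb V>> == hdim V by [].
rewrite -dimvf; congr (\dim _); apply/vspaceP => v; rewrite memvf (hbase_exp v).
by apply: memv_suml => a _; apply: memvZ; apply: memv_span; exact: mem_nth.
Qed.
End HilbertSchmidtTheory.

Section DirectSumInjection.
Variables (C : numClosedFieldType) (Y : finType) (V : Y -> vectType C).

Definition supported y (v : V y) : sect V := mksect (@dfwith Y V (fun=> 0) y v).

Lemma supported_in y (v : V y) : supported v y = v.
Proof. by rewrite mksectE dfwith_in. Qed.

Lemma supported_out y z (v : V y) : y != z -> supported v z = 0.
Proof. by move=> ne; rewrite mksectE dfwith_out. Qed.

Fact supported_linear y : linear (@supported y).
Proof.
move=> a s t; apply/sectP => z; rewrite sectDE sectZE.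
have [<-|ne] := eqVneq y z; first by rewrite !supported_in.
by rewrite !supported_out // scaler0 addr0.
Qed.
HB.instance Definition _ y :=
  GRing.isLinear.Build C (V y) (sect V) _ (@supported y) (@supported_linear y).
End DirectSumInjection.

Section BundleHilb.
Variables (C : numClosedFieldType) (X : finspace C).

Definition bobj := X -> hilb C.

(** The weight of [x] enters here so that it becomes the scale factor of the
simple object over [x]. *)
Definition bhom (V W : bobj) : hilb C :=
  dsum (@wt_gt0 C X) (fun x => hs_hilb (V x) (W x)).
Definition fib (V W : bobj) (f : bhom V W) (x : X) : 'Hom(V x, W x) :=
  (f : sect (fun x => hs_hilb (V x) (W x))) x.
Definition mkb (V W : bobj) (f : forall x, 'Hom(V x, W x)) : bhom V W :=
  mksect (V := fun x => hs_hilb (V x) (W x)) f.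

Lemma fibK (V W : bobj) (f : forall x, 'Hom(V x, W x)) x : fib (mkb f) x = f x.
Proof. exact: mksectE. Qed.
Lemma bhomP (V W : bobj) (f g : bhom V W) : (forall x v, fib f x v = fib g x v) -> f = g.
Proof. by move=> e; apply/sectP => x; apply/lfunP => v; exact: e. Qed.
Lemma fibDZ (V W : bobj) a (f g : bhom V W) x : fib (a *: f + g) x = a *: fib f x + fib g x.
Proof. by rewrite /fib sectDE sectZE. Qed.
Lemma fibZ (V W : bobj) a (f : bhom V W) x : fib (a *: f) x = a *: fib f x.
Proof. exact: sectZE. Qed.
Lemma fib0 (V W : bobj) x : fib (0 : bhom V W) x = 0. Proof. exact: sect0E. Qed.
Lemma bhom_ipE (V W : bobj) (f g : bhom V W) :
  ip f g = \sum_x wt x * hs_ip (fib f x) (fib g x).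
Proof. by []. Qed.

Definition bhid (V : bobj) : bhom V V := mkb (fun x => \1%VF).
Definition bhcomp (U V W : bobj) (f : bhom V W) (g : bhom U V) : bhom U W :=
  mkb (fun x => fib f x \o fib g x)%VF.
Definition bhdag (V W : bobj) (f : bhom V W) : bhom W V := mkb (fun x => adj (fib f x)).

Lemma bhidE V x v : fib (bhid V) x v = v.
Proof. by rewrite fibK id_lfunE. Qed.
Lemma bhcompE U V W (f : bhom V W) (g : bhom U V) x v :
  fib (bhcomp f g) x v = fib f x (fib g x v).
Proof. by rewrite fibK comp_lfunE. Qed.

Definition bundle_hstar : hstar C.
Proof.
refine (@HStar C bobj bhom bhid bhcomp bhdag _ _ _ _ _ _ _ _ _).
- by move=> U V W T f g h; apply: bhomP => x v; rewrite !bhcompE.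
- by move=> U V f; apply: bhomP => x v; rewrite bhcompE bhidE.
- by move=> U V f; apply: bhomP => x v; rewrite bhcompE bhidE.
- move=> U V W; split=> [g a f f'|f a g g']; apply: bhomP => x v.
    by rewrite bhcompE !fibDZ !add_lfunE !scale_lfunE !bhcompE.
  by rewrite bhcompE !fibDZ !add_lfunE !scale_lfunE !bhcompE linearP.
- move=> U V a f g; apply: bhomP => x v.
  by rewrite fibK !fibDZ adj_antilin !add_lfunE !scale_lfunE !fibK.
- by move=> U V f; apply: bhomP => x v; rewrite !fibK adjK.
- by move=> U V W f g; apply: bhomP => x v; rewrite !fibK adj_comp.
- move=> U V W f g h; rewrite !bhom_ipE; apply: eq_bigr => x _.
  by rewrite !fibK hs_ip_compl.
- move=> U V W f g h; rewrite !bhom_ipE; apply: eq_bigr => x _.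
  by rewrite !fibK hs_ip_compr.
Defined.

Arguments bundle_hstar : simpl never.

Lemma bundle_compE (U V W : bundle_hstar) (f : hom V W) (g : hom U V) x v :
  fib (f \oc g) x v = fib f x (fib g x v).
Proof. exact: bhcompE. Qed.
Lemma bundle_idE (V : bundle_hstar) x v : fib (hid V) x v = v.
Proof. exact: bhidE. Qed.
Lemma bundle_dagE (V W : bundle_hstar) (f : hom V W) x : fib (hdag f) x = adj (fib f x).
Proof. exact: fibK. Qed.
Lemma bundle_homP (V W : bundle_hstar) (f g : hom V W) :
  (forall x v, fib f x v = fib g x v) -> f = g.
Proof. exact: bhomP. Qed.

Lemma bundle_direct_sums : has_direct_sums bundle_hstar.
Proof.
move=> n V.
pose S : bundle_hstar := fun x => dsum (fun=> ltr01 : 0 < 1 :> C) (fun k => V k x).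
pose inj k : hom (V k) S := mkb (fun x =>
  linfun (supported (V := fun k => V k x) (y := k)) : 'Hom(V k x, S x)).
have lp x k : linear (fun s : S x => (s : sect (fun k => V k x)) k).
  by move=> a s t; rewrite sectDE sectZE.
pose prj k : hom S (V k) := mkb (fun x => mkhom (@lp x k)).
have ie k x v : fib (inj k) x v = supported (V := fun k => V k x) v.
  by rewrite fibK lfunE.
have pe k x v : fib (prj k) x v = (v : sect (fun k => V k x)) k.
  by rewrite fibK mkhomE.
exists S, inj, prj; split.
- by move=> k; apply: bundle_homP => x v; rewrite bundle_compE ie pe supported_in bundle_idE.
- move=> k l ne; apply: bundle_homP => x v.
  by rewrite bundle_compE ie pe supported_out 1?eq_sym // fib0 lfunE.
- apply: bundle_homP => x v; rewrite bundle_idE.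
  have -> : fib (\sum_k inj k \oc prj k) x v = \sum_k fib (inj k \oc prj k) x v.
    elim/big_rec2: _ => [|k s t _ <-]; first by rewrite fib0 lfunE.
    by rewrite -[X in fib (X + _)]scale1r fibDZ scale1r add_lfunE.
  apply/sectP => k.
  have -> : ((\sum_k0 fib (inj k0 \oc prj k0) x v : S x) : sect (fun k => V k x)) k =
      \sum_l (fib (inj l \oc prj l) x v : sect (fun k => V k x)) k.
    by apply: (big_morph (fun s : S x => (s : sect (fun k => V k x)) k)) => [s t|];
       rewrite ?sectDE ?sect0E.
  rewrite (bigD1 k) // bundle_compE ie pe supported_in big1 => [|l ne]; first exact: addr0.
  by rewrite bundle_compE ie supported_out.
Qed.

Lemma bundle_idempotents_split : idempotents_split bundle_hstar.
Proof.
move=> V p pp.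
have ppE x v : fib p x (fib p x v) = fib p x v by rewrite -bundle_compE pp.
pose W : bundle_hstar := fun x => sub_hilb (limg (fib p x)).
pose s : hom W V := mkb (fun x => linfun vsval : 'Hom(W x, V x)).
have lr x : linear (fun v => vsproj (limg (fib p x)) (fib p x v) : W x).
  by move=> a u v; rewrite !linearP.
pose r : hom V W := mkb (fun x => mkhom (@lr x)).
have re x v : fib r x v = vsproj (limg (fib p x)) (fib p x v) by rewrite fibK mkhomE.
have se x v : fib s x v = vsval v by rewrite fibK lfunE.
exists W, r, s; split; apply: bundle_homP => x v; rewrite bundle_compE re se.
  rewrite bundle_idE; apply: subvs_inj; rewrite vsprojK ?memv_img ?memvf //.
  by case/memv_imgP: (subvsP v) => u _ ->; exact: ppE.
by rewrite vsprojK // memv_img ?memvf.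
Qed.

(** The line over [x] is the column of the identity bundle at [x]; up to
isomorphism these are the simple objects. *)
Definition line (x : X) : bundle_hstar := fun y => bid X y x.

(** Morphisms out of the line over [x] are the elements of the fibre at [x]; away
from [x] both [bid_sc u] and the extension of [v] by zero vanish. *)
Definition line_map (V : bundle_hstar) x (v : V x) : hom (line x) V :=
  mkb (fun y => linfun (fun u : line x y => bid_sc u *: supported (V := V) v y)).

Lemma line_mapE (V : bundle_hstar) x (v : V x) y u :
  fib (line_map v) y u = bid_sc u *: supported (V := V) v y.
Proof.
rewrite fibK linfun_linE // => a s t.
by rewrite bid_sc_scalar scalerDl scalerA.
Qed.

Lemma line_map_bid1 (V : bundle_hstar) x (v : V x) :
  fib (line_map v) x (bid1 x) = v.
Proof. by rewrite line_mapE bid_sc1 scale1r supported_in. Qed.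

Lemma line_ext (V : bundle_hstar) x (f g : hom (line x) V) :
  fib f x (bid1 x) = fib g x (bid1 x) -> f = g.
Proof.
move=> e; apply: bundle_homP => y u.
have [ey|/eqP ne] := pselect (y = x); last by rewrite (bid0 u ne) !linear0.
by case: _ / ey in f g e u *; rewrite [u]bidE !linearZ /= e.
Qed.

Lemma bid1_neq0 (x : X) : bid1 x != 0.
Proof.
apply/eqP => e; have := bid_sc1 x; rewrite e /bid_sc big1 => [/eqP|i _].
  by rewrite eq_sym oner_eq0.
by rewrite mxE.
Qed.

Lemma hid_line_neq0 x : hid (line x) != 0.
Proof.
apply: contra_neq (bid1_neq0 x) => e.
by rewrite -[bid1 x](bundle_idE (V := line x)) e fib0 lfunE.
Qed.

(** If the mono [m] is nonzero, its component at [x] hits the generator of the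
line, which gives a section of [m]. *)
Lemma line_simple x : is_simple (line x).
Proof.
split=> [|V m mm]; first exact: hid_line_neq0.
have [[v v0]|n0] := pselect (exists v, fib m x v != 0); last first.
  left; apply: bundle_homP => y v; rewrite fib0 lfunE /=.
  have [e|/eqP ne] := pselect (y = x); last by rewrite (bid0 (fib m y v) ne).
  case: _ / e in m mm n0 v *; apply/eqP; apply: contraT => h.
  by case: n0; exists v.
right; set c := bid_sc (fib m x v).
have mvE : fib m x v = c *: bid1 x by exact: bidE.
have c0 : c != 0 by apply: contraNneq v0 => e; rewrite mvE e scale0r.
have mg : m \oc line_map (c^-1 *: v) = hid (line x).
  apply: line_ext; rewrite bundle_compE line_map_bid1 bundle_idE linearZ /= mvE.
  by rewrite scalerA mulVf // scale1r.
exists (line_map (c^-1 *: v)); split=> //.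
by apply: mm; rewrite hcompA mg hcomp1l hcomp1r.
Qed.

Lemma line_map_mono (V : bundle_hstar) x (v : V x) : v != 0 -> is_mono (line_map v).
Proof.
move=> v0 W f g e; apply: bundle_homP => y u.
have [ey|/eqP ne] := pselect (y = x); last by rewrite (bid0 (fib f y u) ne) (bid0 (fib g y u) ne).
case: _ / ey in v v0 f g e *.
have := congr1 (fun h => fib h y u) e; rewrite !bundle_compE !line_mapE supported_in.
move/eqP; rewrite -subr_eq0 -scalerBl scaler_eq0 (negPf v0) orbF subr_eq0 => /eqP e'.
by rewrite (bidE (fib f y u)) (bidE (fib g y u)) e'.
Qed.

Lemma line_cover V : is_simple V -> exists x, isomorphic (line x) V.
Proof.
move=> [V0 sV].
have [x [v v0]] : exists x, exists v : V x, v != 0.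
  apply: contrapT => h; case/eqP: V0; apply: bundle_homP => x v.
  rewrite bundle_idE fib0 lfunE; apply/eqP; apply: contraT => v0.
  by case: h; exists x, v.
exists x, (line_map v); have [e|//] := sV _ _ (line_map_mono v0).
by case/eqP: v0; rewrite -[v]line_map_bid1 e fib0 lfunE.
Qed.

Lemma line_inj x y : isomorphic (line x) (line y) -> x = y.
Proof.
move=> [f [g [gf _]]]; apply/eqP; apply: contraT => ne.
have := bid1_neq0 x; rewrite -[bid1 x](bundle_idE (V := line x)) -gf bundle_compE.
by rewrite (bid0 (fib f x (bid1 x)) ne) linear0 eqxx.
Qed.

Definition bundle2hilb : mark2hilb C :=
  Mark2Hilb (conj bundle_direct_sums bundle_idempotents_split)
    line_simple line_cover line_inj.

(** The trace of the identity of a line is [1], whatever the norm of its generator. *)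
Lemma bundle_scale_factor x : scale_factor (H := bundle2hilb) x = wt x.
Proof.
rewrite /scale_factor bhom_ipE (bigD1 x) //= [X in _ + X]big1 => [|y ne].
  rewrite hs_ipE addr0 (eq_bigr (fun=> 1)) => [|a _]; last by rewrite bundle_idE hbase_on eqxx.
  rewrite sumr_const card_ord hdimE.
  by rewrite (_ : dim _ = 1%N) ?mulr1 //= dim_matrix eqxx.
rewrite hs_ipE big1 ?mulr0 // => a _.
by rewrite (bid0 (hbase a) ne) linear0 ip0l.
Qed.
End BundleHilb.

(** * The 2-functor from weighted sets to 2-Hilbert spaces *)

Section Components.
Variables (C : numClosedFieldType) (H K L M : hstar C).

Lemma nt_vcE (F G G' : sfun H K) (t : ntrans G G') (s : ntrans F G) x :
  nt_vc t s x = t x \oc s x.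
Proof. by []. Qed.
Lemma nt_hcE (G G' : sfun K L) (F F' : sfun H K) (t : ntrans G G') (s : ntrans F F') x :
  nt_hc t s x = t (F' x) \oc sf1 G (s x).
Proof. by []. Qed.
Lemma nt_idE (F : sfun H K) x : nt_id F x = hid (F x). Proof. by []. Qed.
Lemma nt_asoE (E : sfun L M) (G : sfun K L) (F : sfun H K) x :
  nt_aso E G F x = hid (E (G (F x))).
Proof. by []. Qed.
Lemma nt_asoIE (E : sfun L M) (G : sfun K L) (F : sfun H K) x :
  nt_asoI E G F x = hid (E (G (F x))).
Proof. by []. Qed.
Lemma nt_luE (F : sfun H K) x : nt_lu F x = hid (F x). Proof. by []. Qed.
Lemma nt_ruE (F : sfun H K) x : nt_ru F x = hid (F x). Proof. by []. Qed.
Lemma nt_ruIE (F : sfun H K) x : nt_ruI F x = hid (F x). Proof. by []. Qed.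
Lemma sf1_compE (G : sfun K L) (F : sfun H K) x y (f : hom x y) :
  sf1 (sfun_comp G F) f = sf1 G (sf1 F f).
Proof. by []. Qed.
(** Passes to components while composition in the target stays folded. *)
Definition ntE := (nt_vcE, nt_hcE, nt_idE, nt_asoE, nt_asoIE, nt_luE, nt_ruE, nt_ruIE).
End Components.

Section InverseFunctor.
Variable C : numClosedFieldType.
Implicit Types X Y Z T : finspace C.

Lemma adj_hc X Y Z (F F' : bundle Y Z) (E E' : bundle X Y) (g : bmap F F') (f : bmap E E') z x :
  adj (bmap_hc g f z x) = bmap_hc (bmap_adj g) (bmap_adj f) z x.
Proof.
apply: adj_uniq; apply: bcomp_ind => [t|a s s' hs hs' t|y v w].
- by rewrite linear0 !ip0l.
- by rewrite linearP !ipDl !ipZl hs hs'.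
apply: bcomp_ind => [|a s s' hs hs'|y' v' w'].
- by rewrite (linear0 (bmap_hc (bmap_adj g) (bmap_adj f) z x)) !ip0r.
- by rewrite (linearP (bmap_hc (bmap_adj g) (bmap_adj f) z x)) !ipDr !ipZr hs hs'.
rewrite !bmap_hcE; have [e|ne] := pselect (y = y'); last first.
  by rewrite !ip_bpure_off //; apply/eqP.
by case: _ / e in v' w' *; rewrite !ip_bpure !adjP.
Qed.

Lemma bextR4 X Y Z T S (K : bundle T S) (G : bundle Z T) (F : bundle Y Z) (E : bundle X Y) s x
    (U : hilb C) (f g : 'Hom(bcomp K (bcomp G (bcomp F E)) s x, U)) :
  (forall t z y (k : K s t) (w : G t z) (v : F z y) (u : E y x),
    f (bpure k (bpure w (bpure v u))) = g (bpure k (bpure w (bpure v u)))) -> f = g.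
Proof.
move=> e; apply: bextR => t z k w r; move: r.
by apply: bext_fun => [a r r'|a r r'|y v u]; rewrite ?bpureDr ?linearP.
Qed.

Definition col X (V : bundle2hilb X) : bundle (point C) X := fun x _ => V x.
Definition colmap X (V W : bundle2hilb X) (f : hom V W) : bmap (col V) (col W) :=
  fun x _ => fib f x.

(** Objects over [X] are morphisms from the one-point space to [X], so that
bundles and bundle maps act on them by composition. *)
Definition act_ob X Y (E : bundle X Y) (V : bundle2hilb X) : bundle2hilb Y :=
  fun y => bcomp E (col V) y tt.

Definition act_hom X Y (E : bundle X Y) (V W : bundle2hilb X) (f : hom V W) :
    hom (act_ob E V) (act_ob E W) :=
  mkb (fun y => bmap_hc (bmap_id E) (colmap f) y tt).

Lemma act_homE X Y (E : bundle X Y) (V W : bundle2hilb X) (f : hom V W) y x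
    (e : E y x) (v : col V x tt) :
  fib (act_hom E f) y (bpure e v) = bpure e (fib f x v : col W x tt).
Proof. by rewrite fibK bmap_hcE bmap_idE. Qed.

Lemma act_ext X Y (E : bundle X Y) (V : bundle2hilb X) (W : bundle2hilb Y)
    (f g : hom (act_ob E V) W) :
  (forall y x (e : E y x) (v : col V x tt), fib f y (bpure e v) = fib g y (bpure e v)) ->
  f = g.
Proof.
by move=> h; apply: bundle_homP => y v; congr (fun_of_lfun _ v); apply: bext => x e w; exact: h.
Qed.

Definition act X Y (E : bundle X Y) : sfun (bundle2hilb X) (bundle2hilb Y).
Proof.
refine (@SFun C _ _ (act_ob E) (act_hom E) _ _ _ _).
- by move=> V; apply: act_ext => y x e v; rewrite act_homE !bundle_idE.
- move=> U V W f g; apply: act_ext => y x e v.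
  by rewrite bundle_compE !act_homE bundle_compE.
- move=> V W a f g; apply: act_ext => y x e v.
  by rewrite fibDZ add_lfunE scale_lfunE !act_homE fibDZ add_lfunE scale_lfunE bpureDr.
- move=> V W f; apply: act_ext => y x e v.
  rewrite act_homE !bundle_dagE fibK adj_hc bmap_hcE; congr (bpure _ _).
  by rewrite /bmap_adj (adj_uniq (g := \1%VF)) ?bmap_idE // => u w; rewrite !lfunE.
Defined.

Lemma act_sf1E X Y (E : bundle X Y) (V W : bundle2hilb X) (f : hom V W) y x
    (e : E y x) (v : col V x tt) :
  fib (sf1 (act E) f) y (bpure e v) = bpure e (fib f x v : col W x tt).
Proof. exact: act_homE. Qed.

Definition act_cell X Y (E F : bundle X Y) (f : bmap E F) : ntrans (act E) (act F).
Proof.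
refine (@NTrans C _ _ (act E) (act F)
  (fun V => mkb (fun y => bmap_hc f (bmap_id (col V)) y tt)) _).
move=> V W g; apply: act_ext => y x e v.
by rewrite !bundle_compE /= !act_homE !fibK !bmap_hcE !bmap_idE.
Defined.

Lemma act_cellE X Y (E F : bundle X Y) (f : bmap E F) V y x (e : E y x) (v : col V x tt) :
  fib (act_cell f V) y (bpure e v) = bpure (f y x e) v.
Proof. by rewrite fibK bmap_hcE bmap_idE. Qed.

Lemma act_ext2 X Y Z (F : bundle Y Z) (E : bundle X Y) (V : bundle2hilb X) (W : bundle2hilb Z)
    (f g : hom (act F (act E V)) W) :
  (forall z y x (u : F z y) (e : E y x) (v : col V x tt),
    fib f z (bpure u (bpure e v)) = fib g z (bpure u (bpure e v))) -> f = g.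
Proof.
move=> h; apply: bundle_homP => z v; congr (fun_of_lfun _ v).
by apply: (bextR (F := E) (E := col V)) => y x u e w; exact: h.
Qed.

(** Since the action is by composition, its compositor is the inverse associator
and its unit coherence is the inverse left unitor. *)
Definition act_comp X Y Z (F : bundle Y Z) (E : bundle X Y) :
  ntrans (sfun_comp (act F) (act E)) (act (bcomp F E)).
Proof.
refine (@NTrans C _ _ (sfun_comp (act F) (act E)) (act (bcomp F E))
  (fun V => mkb (fun z => bassoI F E (col V) z tt)) _).
move=> V W g; apply: act_ext2 => z y x u e v.
by rewrite !bundle_compE /= !act_homE !fibK !bassoIE bmap_hcE bmap_idE.
Defined.

Lemma act_compE X Y Z (F : bundle Y Z) (E : bundle X Y) V z y x
    (u : F z y) (e : E y x) (v : col V x tt) :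
  fib (act_comp F E V) z (bpure u (bpure e v)) = bpure (bpure u e : bcomp F E z x) v.
Proof. by rewrite fibK bassoIE. Qed.

Definition act_unit X : ntrans (sfun_id (bundle2hilb X)) (act (bid X)).
Proof.
refine (@NTrans C _ _ (sfun_id (bundle2hilb X)) (act (bid X))
  (fun V => mkb (fun x => bluI (col V) x tt)) _).
move=> V W g; apply: bundle_homP => x v.
by rewrite !bundle_compE /= !fibK !bluIE bmap_hcE bmap_idE.
Defined.

Lemma act_unitE X V x (v : col V x tt) : fib (act_unit X V) x v = bpure (bid1 x) v.
Proof. by rewrite fibK bluIE. Qed.

Lemma bmap_at X Y (E F : bundle X Y) (f g : bmap E F) y x : f = g -> f y x = g y x.
Proof. by move->. Qed.
Arguments bmap_at {X Y E F f g} y x.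

(** Inverses of the components of a natural transformation are natural. *)
Lemma inv2_components (H K : TwoHilbM C) (F G : mor H K) (t : cell F G) :
  (forall x, is_iso ((t : ntrans _ _) x)) -> inv2 t.
Proof.
move: t => /= t iso; pose s x := sval (cid (iso x)).
have st x : s x \oc t x = hid (F x) by have [] := svalP (cid (iso x)).
have ts x : t x \oc s x = hid (G x) by have [] := svalP (cid (iso x)).
have sn x y (f : hom x y) : s y \oc sf1 G f = sf1 F f \oc s x.
  rewrite -[LHS]hcomp1r -(ts x) hcompA -(hcompA _ _ (t x)) -nt_nat.
  by rewrite (hcompA (s y)) st hcomp1l.
exists (NTrans sn : ntrans G F); split; apply: ntransP => x; [exact: st|exact: ts].
Qed.

Lemma bundle_iso X (V W : bundle2hilb X) (f : hom V W)
    (g : forall x, 'Hom(W x, V x)) :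
  (forall x, (g x \o fib f x)%VF = \1%VF) -> (forall x, (fib f x \o g x)%VF = \1%VF) ->
  is_iso f.
Proof.
move=> gf fg; exists (mkb g); split; apply: bundle_homP => x v.
  by rewrite bundle_compE bundle_idE fibK -comp_lfunE gf id_lfunE.
by rewrite bundle_compE bundle_idE fibK -[LHS]comp_lfunE fg id_lfunE.
Qed.

Definition bundle_functor : psfun (FinSpaces C) (TwoHilbM C) :=
  @PsFun (FinSpaces C) (TwoHilbM C) (@bundle2hilb C) act act_cell act_comp act_unit.

Theorem bundle_weak2functor : is_weak2functor bundle_functor.
Proof.
split=> /=.
- move=> X Y E; apply: ntransP => V; apply: act_ext => y x e v.
  by rewrite act_cellE bundle_idE bmap_idE.
- move=> X Y E F G t s; apply: ntransP => V; apply: act_ext => y x e v.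
  by rewrite bundle_compE !act_cellE bmap_vcE.
- move=> X Y Z F E; apply: inv2_components => V.
  apply: (bundle_iso (g := fun z => basso F E (col V) z tt)) => z; rewrite fibK.
    exact: (bmap_at z (tt : point C) (fin_asoIK F E (col V))).
  exact: (bmap_at z (tt : point C) (fin_asoK F E (col V))).
- move=> X; apply: inv2_components => V.
  apply: (bundle_iso (g := fun x => blu (col V) x tt)) => x; rewrite fibK.
    exact: (bmap_at x (tt : point C) (fin_luIK (col V))).
  exact: (bmap_at x (tt : point C) (fin_luK (col V))).
- move=> X Y Z F F' E E' t s; apply: ntransP => V; apply: act_ext2 => z y x u e v.
  rewrite !ntE !bundle_compE act_sf1E !act_cellE !act_compE act_cellE.
  by rewrite bmap_hcE.
- move=> X Y Z T G F E; apply: ntransP => V.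
  rewrite !ntE ?sf1_id !(hcomp1l, hcomp1r); apply: bundle_homP => t r.
  congr (fun_of_lfun _ r); apply: (bextR4 (F := E) (E := col V)) => z y x w u e v.
  rewrite !bundle_compE act_sf1E !act_compE.
  rewrite act_cellE.
  by rewrite bassoE.
- move=> X Y E; apply: ntransP => V.
  rewrite !ntE ?sf1_id !(hcomp1l, hcomp1r); apply: act_ext => y x e v.
  by rewrite !bundle_compE bundle_idE act_unitE act_compE act_cellE bluE bid_sc1 scale1r.
- move=> X Y E; apply: ntransP => V.
  rewrite !ntE ?sf1_id !(hcomp1l, hcomp1r); apply: act_ext => y x e v.
  by rewrite !bundle_compE bundle_idE act_sf1E act_unitE act_compE act_cellE bruE bid_sc1 scale1r.
Qed.
End InverseFunctor.

(** * Reconstructing a 2-Hilbert space from its simple objects *)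

Section Unit.
Variable C : numClosedFieldType.
Implicit Types H K L : mark2hilb C.

Definition hom_fibres H (x : H) : bundle2hilb (bracket_ob H) := fun i => hom (mobj i) x.

(** The restricted Yoneda functor to the marked simple objects. *)
Definition hom_functor H : sfun H (bundle2hilb (bracket_ob H)).
Proof.
refine (@SFun C H (bundle_hstar (bracket_ob H)) (@hom_fibres H)
  (fun x y f => mkb (V := hom_fibres x) (W := hom_fibres y) (fun i => linfun (hcomp f))) _ _ _ _).
- by move=> x; apply: bundle_homP => i u; rewrite bundle_idE fibK lfunE /= hcomp1l.
- move=> x y z f g; apply: bundle_homP => i u.
  by rewrite bundle_compE !fibK !lfunE /= hcompA.
- move=> x y a f g; apply: bundle_homP => i u.
  by rewrite fibDZ !fibK add_lfunE scale_lfunE !lfunE /= hcompDl.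
- move=> x y f; apply: bundle_homP => i u.
  rewrite bundle_dagE !fibK lfunE /=; apply: ip_inj => v.
  by rewrite -adjP lfunE /= ip_hcompl.
Defined.

Lemma hom_functorE H (x y : H) (f : hom x y) (i : bracket_ob H) (u : hom (mobj i) x) :
  fib (sf1 (hom_functor H) f) i u = f \oc u.
Proof. by rewrite fibK lfunE. Qed.

(** Acting with [bracket_mor F] on the fibres of [x] is convolving over the marked
simple objects, so that [comp_map] is the comparison with the fibres of [F x]. *)
Definition hom_functor_nat H K (F : sfun H K) :
  ntrans (sfun_comp (act (bracket_mor F)) (hom_functor H)) (sfun_comp (hom_functor K) F).
Proof.
refine (@NTrans C _ _ (sfun_comp (act (bracket_mor F)) (hom_functor H))
  (sfun_comp (hom_functor K) F)
  (fun x => mkb (V := act_ob (bracket_mor F) (hom_functor H x)) (W := hom_functor K (F x))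
     (fun l => comp_map F x l tt)) _).
move=> x y f; apply: act_ext => l i g u.
rewrite !bundle_compE !sf1_compE act_sf1E !fibK comp_mapE lfunE /= comp_mapE.
by rewrite lfunE /= sf1_comp hcompA.
Defined.

Lemma hom_functor_natE H K (F : sfun H K) x l i (g : bracket_mor F l i)
    (f : hom (mobj i) x) :
  fib (hom_functor_nat F x) l (bpure g (f : col (hom_functor H x) i tt)) = sf1 F f \oc g.
Proof. by rewrite fibK comp_mapE. Qed.

Definition hom_pseudonat :
  pseudonat (psfun_id (TwoHilbM C)) (psfun_comp (bundle_functor C) (bracket C)).
Proof.
refine (@Pseudonat (TwoHilbM C) (TwoHilbM C) (psfun_id (TwoHilbM C))
  (psfun_comp (bundle_functor C) (bracket C)) hom_functor hom_functor_nat _ _ _ _).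
- move=> H K F; apply: inv2_components => x.
  have [u v] := comp_map_unitary F x.
  apply: (bundle_iso (g := fun l => adj (comp_map F x l tt))) => l; rewrite fibK.
    exact: (bmap_at l (tt : point C) u).
  exact: (bmap_at l (tt : point C) v).
- move=> /= H K F G s; apply: ntransP => x.
  rewrite !ntE sf1_id hcomp1r hcomp1l; apply: act_ext => l i g f.
  rewrite !bundle_compE act_cellE !hom_functor_natE hom_functorE bracket_cellE.
  by rewrite !hcompA nt_nat.
- move=> /= H K L G F; apply: ntransP => x.
  rewrite !ntE ?sf1_id ?(hcomp1l, hcomp1r).
  apply: (act_ext2 (F := bracket_mor G) (E := bracket_mor F)) => l m i g f u.
  rewrite !bundle_compE act_compE act_cellE act_sf1E bracket_compositorE.
  by rewrite !hom_functor_natE sf1_compE sf1_comp hcompA.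
- move=> /= H; apply: ntransP => x.
  rewrite !ntE ?sf1_id ?(hcomp1l, hcomp1r); apply: bundle_homP => i u.
  rewrite !bundle_compE act_unitE act_cellE bracket_unitE hom_functor_natE /=.
  by rewrite hcomp1r bundle_idE.
Defined.

(** A fully faithful *-functor that is surjective on objects up to unitary
isomorphism is an equivalence; transporting along unitaries makes the inverse
compatible with the involution. *)
Lemma unitary_equivalence (H K : mark2hilb C) (F : sfun H K) :
  (forall x y (f g : hom x y), sf1 F f = sf1 F g -> f = g) ->
  (forall x y (g : hom (F x) (F y)), exists f, sf1 F f = g) ->
  (forall V : K, exists x (u : hom (F x) V), hdag u \oc u = hid _ /\ u \oc hdag u = hid V) ->
  @equiv1 (TwoHilbM C) H K F.
Proof.
move=> faith full surj.
pose G0 V := sval (cid (surj V)).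
pose u V : hom (F (G0 V)) V := sval (cid (svalP (cid (surj V)))).
have uu V : hdag (u V) \oc u V = hid _ by have [] := svalP (cid (svalP (cid (surj V)))).
have uV V : u V \oc hdag (u V) = hid V by have [] := svalP (cid (svalP (cid (surj V)))).
pose pre x y (g : hom (F x) (F y)) := sval (cid (full x y g)).
have preE x y g : sf1 F (@pre x y g) = g by exact: svalP (cid (full x y g)).
(* The inverse functor lifts the conjugates by the chosen unitaries. *)
pose G1 V W (g : hom V W) := pre _ _ (hdag (u W) \oc (g \oc u V)).
have uG V W g : u W \oc sf1 F (@G1 V W g) = g \oc u V.
  by rewrite preE hcompA uV hcomp1l.
have inj V W (f g : hom (G0 V) (G0 W)) : u W \oc sf1 F f = u W \oc sf1 F g -> f = g.
  by move=> e; apply: faith; rewrite -[LHS]hcomp1l -[RHS]hcomp1l -!uu -!hcompA e.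
have G1_id V : G1 V V (hid V) = hid (G0 V).
  by apply: inj; rewrite uG hcomp1l sf1_id hcomp1r.
have G1_comp U V W (f : hom V W) (g : hom U V) : G1 _ _ (f \oc g) = G1 _ _ f \oc G1 _ _ g.
  by apply: inj; rewrite uG sf1_comp hcompA uG -!hcompA uG.
have G1_lin V W : linear (@G1 V W).
  move=> a f g; apply: inj; rewrite uG hcompDl (sf1_linear F) hcompDr !uG.
  by [].
have G1_dag V W (f : hom V W) : G1 _ _ (hdag f) = hdag (G1 _ _ f).
  by apply: faith; rewrite sf1_dag !preE !hdagM hdagK hcompA.
pose G := SFun G1_id G1_comp G1_lin G1_dag.
pose eta0 x : hom x (G0 (F x)) := pre _ _ (hdag (u (F x))).
have eta0_nat x y (f : hom x y) : eta0 y \oc sf1 (sfun_id H) f = sf1 (sfun_comp G F) f \oc eta0 x.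
  apply: faith; rewrite !sf1_comp !preE /= -!hcompA; congr (_ \oc _).
  by rewrite uV hcomp1r.
pose eta : ntrans (sfun_id H) (sfun_comp G F) :=
  @NTrans C H H (sfun_id H) (sfun_comp G F) eta0 eta0_nat.
have eps_nat V W (f : hom V W) : u W \oc sf1 (sfun_comp F G) f = sf1 (sfun_id K) f \oc u V.
  exact: uG.
pose eps : ntrans (sfun_comp F G) (sfun_id K) :=
  @NTrans C K K (sfun_comp F G) (sfun_id K) u eps_nat.
exists G, eta, eps; split; apply: inv2_components => x /=.
  exists (pre _ _ (u (F x))); split; apply: faith; rewrite sf1_comp !preE sf1_id //.
by exists (hdag (u x)).
Qed.

Lemma direct_sums_fin (H : hstar C) (T : finType) (x : T -> H) : has_direct_sums H ->
  exists (s : H) (inj : forall t, hom (x t) s) (prj : forall t, hom s (x t)),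
    [/\ forall t, prj t \oc inj t = hid (x t),
        forall t t', t != t' -> prj t \oc inj t' = 0
      & \sum_t inj t \oc prj t = hid s].
Proof.
move=> /(_ #|T| (x \o enum_val))[s [inj [prj [h1 h2 h3]]]] /=.
pose inj' t := ecast u (hom (x u) s) (enum_rankK t) (inj (enum_rank t)).
pose prj' t := ecast u (hom s (x u)) (enum_rankK t) (prj (enum_rank t)).
have ie k : inj' (enum_val k) = inj k.
  rewrite /inj'; move: (enum_rankK _); rewrite enum_valK => e.
  by rewrite (eq_axiomK e).
have pe k : prj' (enum_val k) = prj k.
  rewrite /prj'; move: (enum_rankK _); rewrite enum_valK => e.
  by rewrite (eq_axiomK e).
exists s, inj', prj'; split.
- by move=> t; rewrite -(enum_rankK t) ie pe; exact: h1.
- move=> t t'; rewrite -(enum_rankK t) -(enum_rankK t') ie pe => ne.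
  by apply: h2; apply: contraNneq ne => ->.
rewrite -h3 (reindex (@enum_val T predT)) /=; last first.
  by exists enum_rank => k _; rewrite ?enum_valK ?enum_rankK.
by apply: eq_bigr => k _; rewrite ie pe.
Qed.

Lemma unitary_of_dim (V W : hilb C) : dim V = dim W ->
  exists f : 'Hom(V, W), (adj f \o f)%VF = \1%VF /\ (f \o adj f)%VF = \1%VF.
Proof.
rewrite -!hdimE => e.
have lf : linear (fun v : V => \sum_a ip (hbase a) v *: hbase (cast_ord e a) : W).
  move=> c v w; rewrite scaler_sumr -big_split; apply: eq_bigr => a _ /=.
  by rewrite ipDr ipZr scalerDl scalerA.
pose f := mkhom lf.
have fE a : f (hbase a) = hbase (cast_ord e a).
  rewrite mkhomE (bigD1 a) //= hbase_on eqxx scale1r big1 ?addr0 // => b ne.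
  by rewrite hbase_on (negPf ne) scale0r.
have iso u v : ip (f u) (f v) = ip u v.
  rewrite [in RHS]parseval [u in LHS]hbase_exp linear_sum ip_suml; apply: eq_bigr => a _.
  rewrite linearZ ipZl /= fE [v in LHS]hbase_exp linear_sum ip_sumr; congr (_ * _).
  rewrite (bigD1 a) //= linearZ ipZr /= fE hbase_on eqxx mulr1 big1 ?addr0 // => b ne.
  rewrite linearZ ipZr /= fE hbase_on (inj_eq (@cast_ord_inj _ _ e)).
  by rewrite eq_sym (negPf ne) mulr0.
exists f; split; first exact: isometry_adj.
apply: isometry_surj_adj iso _ => w; exists (\sum_b ip (hbase b) w *: hbase (cast_ord (esym e) b)).
rewrite linear_sum [LHS]hbase_exp; apply: eq_bigr => b _.
by rewrite linearZ /= fE cast_ordKV.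
Qed.

Lemma dim_bij (V W : vectType C) (f : 'Hom(V, W)) (g : 'Hom(W, V)) :
  (forall v, g (f v) = v) -> (forall w, f (g w) = w) -> dim V = dim W.
Proof.
move=> gf fg; have k0 : lker f == 0%VS.
  by apply/lker0P; exact: can_inj gf.
rewrite -!dimvf -(limg_dim_eq (f := f)) ?(eqP k0) ?capv0 //; congr (\dim _).
by apply/vspaceP => w; rewrite memvf -[w]fg memv_img ?memvf.
Qed.

(** A direct sum of [dim (V i)] copies of each [e_i] has fibres of the dimensions of
[V].  Hilbert spaces of equal dimension are unitarily isomorphic, so that it does
not matter whether the inclusions of the direct sum are isometries. *)
Lemma hom_functor_ess_surj H (V : bundle2hilb (bracket_ob H)) :
  exists (x : H) (u : hom (hom_functor H x) V),
    hdag u \oc u = hid _ /\ u \oc hdag u = hid V.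
Proof.
(* [T] indexes a basis of each [V i], hence the copies of [e_i] in the sum. *)
pose T : finType := {i : midx H & 'I_(hdim (V i))}.
have [s [inj [prj [h1 h2 h3]]]] :=
  direct_sums_fin (fun t : T => mobj (tag t)) (mcauchy H).1.
have dimE i : dim (hom (mobj i) s) = dim (V i).
  pose I a := inj (Tagged (fun i => 'I_(hdim (V i))) a) : hom (mobj i) s.
  pose P a := prj (Tagged (fun i => 'I_(hdim (V i))) a) : hom s (mobj i).
  have lf : linear (fun v : V i => \sum_a ip (hbase a) v *: I a).
    move=> c v w; rewrite scaler_sumr -big_split; apply: eq_bigr => a _ /=.
    by rewrite ipDr ipZr scalerDl scalerA.
  have lg : linear (fun u : hom (mobj i) s =>
      \sum_a (ip (hid (mobj i)) (P a \oc u) / scale_factor i) *: (hbase a : V i)).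
    move=> c v w; rewrite scaler_sumr -big_split; apply: eq_bigr => a _ /=.
    by rewrite hcompDr ipDr ipZr scalerA -scalerDl mulrDl mulrA.
  have PI a b : P a \oc I b = (a == b)%:R *: hid (mobj i).
    have [<-|ne] := eqVneq a b.
      by rewrite scale1r; exact: (h1 (Tagged (fun i => 'I_(hdim (V i))) a)).
    rewrite scale0r.
    apply: (h2 (Tagged (fun i => 'I_(hdim (V i))) a) (Tagged (fun i => 'I_(hdim (V i))) b)).
    by rewrite eq_Tagged.
  apply: (dim_bij (f := mkhom lg) (g := mkhom lf)) => [u|v]; rewrite !mkhomE.
    pose F j a := inj (Tagged (fun i => 'I_(hdim (V i))) a) \oc
      prj (Tagged (fun i => 'I_(hdim (V i))) (a : 'I_(hdim (V j)))) \oc u.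
    have eu : u = \sum_a I a \oc (P a \oc u).
      transitivity (\sum_j \sum_a F j a).
        rewrite -{1}[u]hcomp1l -h3 comp_suml sig_big_dep.
        by apply: eq_bigr => -[].
      rewrite (bigD1 i) //= [X in _ + X]big1 => [|j ne]; last first.
        apply: big1 => a _; rewrite /F -hcompA (hom_diff_mark (_ \oc u)) ?comp0r //.
        by rewrite eq_sym.
      by rewrite addr0; apply: eq_bigr => a _; rewrite hcompA.
    rewrite [RHS]eu; apply: eq_bigr => a _.
    rewrite [P a \oc u in RHS]hom_same_mark compZr hcomp1r; congr (_ *: _).
    rewrite ip_sumr (bigD1 a) //= ipZr hbase_on eqxx mulr1 big1 ?addr0 // => b ne.
    by rewrite ipZr hbase_on eq_sym (negPf ne) mulr0.
  rewrite [RHS]hbase_exp; apply: eq_bigr => a _; congr (_ *: _).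
  rewrite comp_sumr (bigD1 a) //= big1 => [|b ne]; last first.
    by rewrite compZr PI eq_sym (negPf ne) scale0r scaler0.
  by rewrite addr0 compZr PI eqxx scale1r ipZr mulfK ?scale_factor_neq0.
pose u i := sval (cid (unitary_of_dim (dimE i))).
have uP i : (adj (u i) \o u i)%VF = \1%VF /\ (u i \o adj (u i))%VF = \1%VF.
  exact: svalP (cid (unitary_of_dim (dimE i))).
exists s, (mkb (V := hom_fibres s) (W := V) u); split; apply: bundle_homP => i v.
  by rewrite bundle_compE bundle_idE bundle_dagE fibK -comp_lfunE (uP i).1 id_lfunE.
by rewrite bundle_compE bundle_idE bundle_dagE fibK -[LHS]comp_lfunE (uP i).2 id_lfunE.
Qed.

Lemma hom_pseudonat_equiv : is_pseudonat_equiv hom_pseudonat.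
Proof.
move=> H; apply: unitary_equivalence => [x y f g e|x y g|V].
- by apply: hom_ext => i u; rewrite -!hom_functorE e.
- have [f fE] := exists_hom_of_maps (fib g).
  by exists f; apply: bundle_homP => i u; rewrite hom_functorE fE.
- exact: hom_functor_ess_surj.
Qed.
End Unit.

(** * Reconstructing a weighted set from its category of bundles *)

Section Counit.
Variable C : numClosedFieldType.
Implicit Types X Y Z : finspace C.

Lemma equiv1_id (B : bicat) (a : B) : equiv1 (id1 a).
Proof.
exists (id1 a), (luI (id1 a)), (lu (id1 a)); split.
  by exists (lu (id1 a)); rewrite luK luIK.
by exists (luI (id1 a)); rewrite luK luIK.
Qed.

Definition value_bundle X : bundle (bracket_ob (bundle2hilb X)) X := fun x i => line (X := X) i x.
Arguments value_bundle : clear implicits.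

(** The marked simple objects over [X] are indexed by the points of [X], with the
same weights up to a propositional equality; along that equality the bundle of
values is an identity 1-morphism. *)
Lemma value_bundle_equiv X : @equiv1 (FinSpaces C) (bracket_ob (bundle2hilb X)) X (value_bundle X).
Proof.
suff h (P : finType) (w k : P -> C) (w0 : forall x, 0 < w x) (k0 : forall x, 0 < k x) :
    (forall x, k x = w x) ->
    @equiv1 (FinSpaces C) (FinSpace k0) (FinSpace w0) (fun y x => bid (FinSpace w0) y x).
  by case: X => P w w0; apply: h => x; exact: bundle_scale_factor.
move=> e; have {}e : k = w by apply: functional_extensionality_dep.
case: _ / e in w0 *; rewrite (Prop_irrelevance w0 k0).
exact: (@equiv1_id (FinSpaces C)).
Qed.

Section Coevaluation.
Variables (X : finspace C) (V : bundle2hilb X).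

Definition line_homs : bundle (point C) (bracket_ob (bundle2hilb X)) :=
  fun i _ => hom (line (X := X) i) V.

Lemma line_map_linear x : linear (fun v : V x => line_map v : hom (line x) V).
Proof.
move=> a v w; apply: line_ext.
by rewrite fibDZ add_lfunE scale_lfunE !line_map_bid1.
Qed.

Lemma line_map0 x : line_map (0 : V x) = 0.
Proof. by apply: line_ext; rewrite line_map_bid1 fib0 lfunE. Qed.

Fact coev_linear x : linear (fun v : V x =>
  bpure (F := value_bundle X) (E := line_homs) (x := tt) (y := x) (bid1 x) (line_map v)).
Proof. by move=> a v w; rewrite line_map_linear bpureDr. Qed.

(** A bundle is recovered from its sections over lines: [coev] writes an element
of a fibre as the value of the section that it spans, and is inverse to the
evaluation [ev]. *)
Definition coev x : 'Hom(V x, bcomp (value_bundle X) line_homs x tt) :=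
  mkhom (@coev_linear x).

Definition ev x : 'Hom(bcomp (value_bundle X) line_homs x tt, V x) :=
  blift (F := value_bundle X) (E := line_homs) (U := V x)
    (fun i (u : value_bundle X x i) (f : line_homs i tt) => fib f x u).

Lemma coevE x (v : V x) :
  coev x v =
  bpure (F := value_bundle X) (E := line_homs) (x := tt) (y := x) (bid1 x) (line_map v).
Proof. exact: mkhomE. Qed.

Lemma evE x i (u : value_bundle X x i) (f : line_homs i tt) :
  ev x (bpure u f) = fib f x u.
Proof.
apply: blift_pure => j; split=> [g a v w|v a g h]; first exact: linearP.
by rewrite fibDZ add_lfunE scale_lfunE.
Qed.

Lemma coevK x : (ev x \o coev x)%VF = \1%VF.
Proof. by apply/lfunP => v; rewrite comp_lfunE id_lfunE coevE evE line_map_bid1. Qed.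

Lemma bpure_line_map x (f : line_homs x tt) :
  bpure (F := value_bundle X) (E := line_homs) (x := tt) (y := x) (bid1 x) f =
  coev x (fib f x (bid1 x)).
Proof. by rewrite coevE; congr bpure; apply: line_ext; rewrite line_map_bid1. Qed.

Lemma evK x : (coev x \o ev x)%VF = \1%VF.
Proof.
apply: (bext (F := value_bundle X) (E := line_homs)) => i u f.
rewrite comp_lfunE id_lfunE evE.
have [e|/eqP ne] := pselect (x = i); last first.
  by rewrite (bid0 (u : bid X x i) ne) linear0 linear0 bpure0l.
case: _ / e in u f *; rewrite [u](@bidE C X x) !linearZ /= bpureZl.
by rewrite bpure_line_map.
Qed.
End Coevaluation.

(** Naturality of the bundle of values: both composites have the fibres of
[act_ob E (line x)], once directly and once through its sections over lines. *)
Definition value_nat X Y (E : bundle X Y) :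
  bmap (bcomp E (value_bundle X)) (bcomp (value_bundle Y) (bracket_mor (act E))) :=
  fun y x => coev (act_ob E (line (X := X) x)) y.

Lemma value_natE X Y (E : bundle X Y) y x i (e : E y i) (u : value_bundle X i x) :
  value_nat E y x (bpure e u) =
  bpure (F := value_bundle Y) (E := bracket_mor (act E)) (x := x) (y := y) (bid1 y)
    (line_map (bpure (F := E) (E := col (line (X := X) x)) (x := tt) e u :
       act_ob E (line (X := X) x) y)).
Proof. exact: coevE. Qed.

Definition value_pseudonat :
  pseudonat (psfun_comp (bracket C) (bundle_functor C)) (psfun_id (FinSpaces C)).
Proof.
refine (@Pseudonat (FinSpaces C) (FinSpaces C) (psfun_comp (bracket C) (bundle_functor C))
  (psfun_id (FinSpaces C)) value_bundle value_nat _ _ _ _).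
- move=> X Y E.
  exists (fun y x => ev (act_ob E (line (X := X) x)) y); split; apply: bmapP => y x.
    exact: (coevK (act_ob E (line (X := X) x)) y).
  exact: (evK (act_ob E (line (X := X) x)) y).
- move=> /= X Y E F s; apply: bmapP => y x; apply: bext => i e u.
  rewrite !bmap_vcE bmap_hcE bmap_idE !value_natE bmap_hcE bmap_idE bracket_cellE.
  congr bpure; apply: line_ext.
  by rewrite bundle_compE !line_map_bid1 act_cellE.
- move=> /= X Y Z F E; apply: bmapP => z x; apply: bextL => y i w e u.
  rewrite !bmap_vcE !bmap_hcE !bmap_idE value_natE bassoE bmap_hcE bmap_idE value_natE.
  rewrite bassoIE bmap_hcE value_natE bmap_idE bassoE bmap_hcE bmap_idE bmap_vcE.
  rewrite bracket_compositorE bracket_cellE.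
  congr bpure; apply: line_ext.
  by rewrite !bundle_compE !line_map_bid1 act_sf1E line_map_bid1 act_compE.
- move=> /= X; apply: bmapP => y x; apply: bext => i v u.
  rewrite !bmap_vcE !bmap_hcE !bmap_idE value_natE.
  (* Off the diagonal, [v] or [u] lies in a zero fibre. *)
  have [e|/eqP ne] := pselect (y = i); last first.
    rewrite [bpure v u in RHS]bid_hom0 // !linear0 (bid0 v ne) bpure0l.
    by rewrite line_map0 bpure0r.
  case: _ / e in u v *; rewrite bluE bruIE bmap_hcE bmap_idE bmap_vcE.
  rewrite bracket_unitE bracket_cellE hcomp1r.
  have [e|/eqP ne] := pselect (y = x).
    case: _ / e in u *.
    rewrite [u in RHS](bidE (u : bid X y y)) scalerA bpureZl -bpureZr.
    congr bpure; apply: line_ext.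
    rewrite line_map_bid1 fibZ scale_lfunE act_unitE.
    rewrite [v in LHS]bidE [u in LHS](bidE (u : bid X y y)).
    by rewrite bpureZl bpureZr scalerA.
  rewrite (bid0 (u : bid X y x) ne) scaler0 bpure0l.
  by rewrite bpure0r line_map0 bpure0r.
Defined.

Theorem bracket_biequivalence : is_biequivalence (bracket C).
Proof.
exists (bundle_functor C); split; first exact: bundle_weak2functor.
split; first by exists (hom_pseudonat C); exact: hom_pseudonat_equiv.
by exists value_pseudonat => X; exact: value_bundle_equiv.
Qed.
End Counit.

Theorem proposition3p14 (R : realType) :
  is_weak2functor (bracket R[i]%R) /\
  unitary_coherence R[i]%R /\
  is_biequivalence (bracket R[i]%R) /\
  unitary_on_2morphisms R[i]%R.
Proof.
split; first exact: bracket_weak2functor.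
split; first exact: bracket_unitary_coherence.
split; first exact: bracket_biequivalence.
exact: bracket_unitary_on_2morphisms.
Qed.
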